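(* The data $(\mathfrak g_{D^\times},\mathfrak g_+,\mathfrak g_-,i_+,i_-,\langle -\mid -\rangle)$ constitute a homotopy Manin triple in dg Lie algebras (with $\mathfrak a=\mathfrak g_{D^\times}$, $\mathfrak a_\pm=\mathfrak g_\pm$, $\iota_\pm=i_\pm$ and $n=1$).
   Context: Everything is over $\mathbb C$; $\otimes=\otimes_{\mathbb C}$ is the algebraic (uncompleted) tensor product. A dg vector space is a cochain complex of $\mathbb C$-vector spaces. $\mathsf s^{-n}\mathbb C$ denotes $\mathbb C$ placed in cohomological degree $n$, with zero differential. Two cochain maps $f,g:V\to W$ are homotopic, $f\simeq g$, if $f-g=dh+hd$ for some linear map $h$ of degree $-1$. A homotopy equivalence is a cochain map invertible up to homotopy. **Homotopy Manin triple (of dg Lie algebras)** $(\mathfrak a,\mathfrak a_\pm,\iota_\pm,\langle-\mid-\rangle,n)$: the data of dg Lie algebras $\mathfrak a,\mathfrak a_+,\mathfrak a_-$, dg Lie algebra maps $\mathfrak a_+\xrightarrow{\iota_+}\mathfrak a\xleftarrow{\iota_-}\mathfrak a_-$, and a degree zero map of dg vector spaces $\langle-\mid-\rangle:\mathfrak a\otimes\mathfrak a\to\mathsf s^{-n}\mathbb C$, such that: (i) the map of dg vector spaces $(\iota_+,\iota_-):\mathfrak a_+\oplus\mathfrak a_-\to\mathfrak a$ is a homotopy equivalence; (ii) the pairing is graded symmetric, $\langle x\mid y\rangle=(-1)^{|x||y|}\langle y\mid x\rangle$, and invariant, $\langle[x,y]\mid z\rangle+(-1)^{|x||y|}\langle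 y\mid[x,z]\rangle=0$ and $\langle dx\mid y\rangle+(-1)^{|x|}\langle x\mid dy\rangle=0$, for homogeneous $x,y,z$; (iii) the pairing is non-degenerate up to homotopy: if $x$ is a cocycle and $\langle x\mid-\rangle$ is homotopic to zero, then $x$ is exact (equivalently, the induced pairing $H(\mathfrak a)\otimes H(\mathfrak a)\to\mathsf s^{-n}\mathbb C$ is non-degenerate); (iv) $\mathfrak a_\pm$ are isotropic up to homotopy: the maps $\langle\iota_\pm(-)\mid\iota_\pm(-)\rangle:\mathfrak a_\pm\otimes\mathfrak a_\pm\to\mathsf s^{-n}\mathbb C$ are homotopic to zero (for each sign separately). **The dg Lie algebras.** Let $\mathfrak g$ be a finite-dimensional simple Lie algebra over $\mathbb C$ with standard nondegenerate invariant symmetric bilinear form $\kappa(-|-)$. Let $B=\mathbb C((w))\otimes\mathbb C((z))$. $\mathfrak g_{D^\times}$ (associated to the punctured formal polydisc) consists of pairs $\bigl(\phi(s)=f(s)+F(s)\,ds,\ \psi(s)=g(s)+G(s)\,ds\bigr)$ of polynomial differential forms in a variable $s$, with $f,F,g,G\in(\mathfrak g\otimes B)[s]$, such that $f(1)=g(1)$, $f(0)\in\mathfrak g\otimes\mathbb C[[w]]\otimes\mathbb C((z))$ and $g(0)\in\mathfrak g\otimes\mathbb C((w))\otimes\mathbb C[[z]]$. The form degree is the cohomological degree, the differential is the de Rham differential in $s$ applied to each component, and the bracket is componentwise $[a\otimes\omega,b\otimes\tau]=[a,b]\otimes\omega\wedge\tau$ for $a,b\in\mathfrak g$ and $B$-valued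 forms $\omega,\tau$. $\mathfrak g_+=\mathfrak g\otimes\mathbb C[[w]]\otimes\mathbb C[[z]]$ in degree $0$; $i_+:\mathfrak g_+\to\mathfrak g_{D^\times}$ sends $x$ to the constant pair $(x,x)$. $\mathfrak g_-$ is the dg Lie algebra of pairs $(f(s)+F(s)ds,\ g(s)+G(s)ds)$ with $f,F,g,G\in(\mathfrak g\otimes w^{-1}z^{-1}\mathbb C[w^{-1},z^{-1}])[s]$, $f(1)=g(1)$, $f(0)=0=g(0)$, with the same differential and bracket; $i_-:\mathfrak g_-\to\mathfrak g_{D^\times}$ is the inclusion. **The pairing.** $\langle-\mid-\rangle:\mathfrak g_{D^\times}\otimes\mathfrak g_{D^\times}\to\mathsf s^{-1}\mathbb C$ is the linear extension of $\langle a\otimes\omega\mid b\otimes\lambda\rangle=\mathsf s^{-1}\tfrac12\,\kappa(a|b)\int_\Sigma\operatorname{res}_w\operatorname{res}_z\,\omega\wedge\lambda$, where for a pair $(\omega_1,\omega_2)$ of forms $\int_\Sigma(\omega_1,\omega_2)=\int_0^1\omega_1-\int_0^1\omega_2$ (integrals of the one-form parts over $s\in[0,1]$), the wedge product is componentwise, and $\operatorname{res}_t:\mathbb C((t))\to\mathbb C$, $\sum_kf_kt^k\mapsto f_{-1}$. *)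

(* Defs.v *)
From HB Require Import structures.
From mathcomp Require Import all_boot all_order all_algebra.
From mathcomp Require Import generic_quotient sesquilinear finmap.
From mathcomp Require Import boolp classical_sets functions cardinality fsbigop.
From mathcomp Require Import reals.
From mathcomp Require Import complex.

Set Implicit Arguments.
Unset Strict Implicit.
Unset Printing Implicit Defensive.

(* Everything is done over a field K, to be the complex
   numbers; tens U V is the algebraic tensor product over K. *)

Import Order.TTheory GRing.Theory Num.Theory.
Local Open Scope classical_set_scope.
Local Open Scope ring_scope.
Local Open Scope quotient_scope.

Section TensorDef.
Variables (K : fieldType) (U V : lmodType K).

(* A sequence stands for the formal sum of its pure tensors.  Negatives need
   no formal symbol, since (- u, v) is one; [tens_zero] is what makes the
   commutative monoid of classes a group. *)
Inductive tens_rel : seq (U * V) -> seq (U * V) -> Prop :=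
| tens_refl s : tens_rel s s
| tens_sym s t : tens_rel s t -> tens_rel t s
| tens_trans s t r : tens_rel s t -> tens_rel t r -> tens_rel s r
| tens_cat s s' t t' :
    tens_rel s s' -> tens_rel t t' -> tens_rel (s ++ t) (s' ++ t')
| tens_catC s t : tens_rel (s ++ t) (t ++ s)
| tens_zero v : tens_rel [:: (0, v)] [::]
| tens_addl u u' v : tens_rel [:: (u + u', v)] [:: (u, v); (u', v)]
| tens_addr u v v' : tens_rel [:: (u, v + v')] [:: (u, v); (u, v')]
| tens_scale a u v : tens_rel [:: (a *: u, v)] [:: (u, a *: v)].

Definition tens_relb (s t : seq (U * V)) : bool := `[< tens_rel s t >].

Fact tens_relb_refl : reflexive tens_relb.
Proof. by move=> s; apply/asboolP/tens_refl. Qed.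
Fact tens_relb_sym : symmetric tens_relb.
Proof. by move=> s t; apply/asboolP/asboolP => /tens_sym. Qed.
Fact tens_relb_trans : transitive tens_relb.
Proof.
by move=> s t r /asboolP h1 /asboolP h2; apply/asboolP/(tens_trans h1 h2).
Qed.

Canonical tens_equiv :=
  EquivRel tens_relb tens_relb_refl tens_relb_sym tens_relb_trans.

Definition tens := {eq_quot tens_equiv}.
HB.instance Definition _ := Choice.on tens.
HB.instance Definition _ := Quotient.on tens.

Let cls (s : seq (U * V)) : tens := \pi_tens s.

Lemma tens_clsP s t : cls s = cls t <-> tens_rel s t.
Proof.
split=> [/eqP|h]; first by rewrite eqquotE => /asboolP.
by apply/eqP; rewrite eqquotE; apply/asboolP.
Qed.

Lemma tens_repr s : tens_rel (repr (cls s)) s.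
Proof. by apply/tens_clsP; rewrite /cls reprK. Qed.

Definition tens_scaleseq (a : K) (s : seq (U * V)) := [seq (a *: p.1, p.2) | p <- s].

Lemma tens_scaleseq_rel a s t :
  tens_rel s t -> tens_rel (tens_scaleseq a s) (tens_scaleseq a t).
Proof.
elim=> {s t}.
- by move=> s; apply: tens_refl.
- by move=> s t _; apply: tens_sym.
- by move=> s t r _ h1 _; apply: tens_trans h1.
- by move=> s s' t t' _ h1 _ h2; rewrite /tens_scaleseq !map_cat; apply: tens_cat.
- by move=> s t; rewrite /tens_scaleseq !map_cat; apply: tens_catC.
- by move=> v; rewrite /= scaler0; apply: tens_zero.
- by move=> u u' v; rewrite /= scalerDr; apply: tens_addl.
- by move=> u v v'; apply: tens_addr.
- by move=> b u v; rewrite /= scalerA mulrC -scalerA; apply: tens_scale.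
Qed.

Definition tens0 : tens := cls [::].
Definition tensD (s t : tens) : tens := cls (repr s ++ repr t).
Definition tensZ a (s : tens) : tens := cls (tens_scaleseq a (repr s)).
Definition tensN (s : tens) : tens := tensZ (-1) s.
Definition tpure u v : tens := cls [:: (u, v)].

Lemma tensDE s t : tensD (cls s) (cls t) = cls (s ++ t).
Proof. by apply/tens_clsP; apply: tens_cat; apply: tens_repr. Qed.
Lemma tensZE a s : tensZ a (cls s) = cls (tens_scaleseq a s).
Proof. by apply/tens_clsP; apply: tens_scaleseq_rel; apply: tens_repr. Qed.
Lemma tens_clsE (t : tens) : t = cls (repr t).
Proof. by rewrite /cls reprK. Qed.

Lemma tensDA : associative tensD.
Proof.
move=> a b c; rewrite (tens_clsE a) (tens_clsE b) (tens_clsE c).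
by rewrite !tensDE catA.
Qed.
Lemma tensDC : commutative tensD.
Proof.
move=> a b; rewrite (tens_clsE a) (tens_clsE b) !tensDE.
by apply/tens_clsP/tens_catC.
Qed.
Lemma tens0D : left_id tens0 tensD.
Proof. by move=> a; rewrite (tens_clsE a) tensDE. Qed.
Lemma tensND : left_inverse tens0 tensN tensD.
Proof.
move=> a; rewrite (tens_clsE a) /tensN tensZE tensDE; apply/tens_clsP.
elim: (repr a) => [|[u v] s IH]; first exact: tens_refl.
set s' := tens_scaleseq _ s in IH *.
change (tens_rel ([:: (-1 *: u, v)] ++ (s' ++ ([:: (u, v)] ++ s))) [::]).
apply: (@tens_trans _ (([:: (-1 *: u, v)] ++ [:: (u, v)]) ++ (s' ++ s))).
  rewrite -!catA; apply: tens_cat; first exact: tens_refl.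
  by rewrite !catA; apply: tens_cat; [exact: tens_catC|exact: tens_refl].
rewrite -[X in tens_rel _ X]cats0; apply: tens_cat => //.
apply: tens_trans (tens_zero v).
by apply: tens_sym; rewrite -[0](addNr u) -scaleN1r; apply: tens_addl.
Qed.

HB.instance Definition _ := GRing.isZmodule.Build tens tensDA tensDC tens0D tensND.

Lemma tensZA a b t : tensZ a (tensZ b t) = tensZ (a * b) t.
Proof.
rewrite (tens_clsE t) !tensZE /tens_scaleseq -map_comp; congr cls.
by apply: eq_map => p /=; rewrite scalerA.
Qed.
Lemma tens1Z : left_id 1 tensZ.
Proof.
move=> t; rewrite (tens_clsE t) !tensZE; congr cls.
by rewrite -[RHS]map_id; apply: eq_map => -[u v] /=; rewrite scale1r.
Qed.
Lemma tensZDr : right_distributive tensZ +%R.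
Proof.
move=> a s t; rewrite (tens_clsE s) (tens_clsE t).
by rewrite /GRing.add /= tensDE !tensZE tensDE /tens_scaleseq map_cat.
Qed.
Lemma tensZDl t : {morph tensZ^~ t : a b / a + b}.
Proof.
move=> a b; rewrite (tens_clsE t) [in RHS]/GRing.add /= !tensZE tensDE.
apply/tens_clsP; elim: (repr t) => [|[u v] s IH]; first exact: tens_refl.
set s1 := tens_scaleseq a s in IH *; set s2 := tens_scaleseq b s in IH *.
set s3 := tens_scaleseq _ s in IH *.
change (tens_rel ([:: ((a + b) *: u, v)] ++ s3)
  (([:: (a *: u, v)] ++ s1) ++ ([:: (b *: u, v)] ++ s2))).
apply: (@tens_trans _ (([:: (a *: u, v)] ++ [:: (b *: u, v)]) ++ (s1 ++ s2))).
  apply: tens_cat => //; rewrite scalerDl; apply: tens_addl.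
rewrite -!catA; apply: tens_cat; first exact: tens_refl.
by rewrite !catA; apply: tens_cat; [exact: tens_catC|exact: tens_refl].
Qed.

HB.instance Definition _ :=
  GRing.Zmodule_isLmodule.Build K tens tensZA tens1Z tensZDr tensZDl.

Lemma tens_sumE (t : tens) : t = \sum_(p <- repr t) tpure p.1 p.2.
Proof.
rewrite [LHS]tens_clsE; elim: (repr t) => [|[u v] s IH]; first by rewrite big_nil.
by rewrite big_cons -IH /GRing.add /= tensDE.
Qed.

Lemma tpure_bilinear : bilinear_for *:%R *:%R tpure.
Proof.
split=> [v|u] a x y /=; rewrite /GRing.add /GRing.scale /= tensZE tensDE;
  apply/tens_clsP.
  exact: tens_addl.
apply: tens_trans (tens_addr _ _ _) _; rewrite -![[:: _; _]]cat1s.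
apply: tens_cat; last exact: tens_refl.
by apply: tens_sym; apply: tens_scale.
Qed.

End TensorDef.

Notation "u \ox v" := (tpure u v) (at level 40, left associativity) : ring_scope.

(* The linear map out of the tensor product induced by b; meaningful only for
   bilinear b, where it does not depend on the chosen representatives. *)
Definition tlift (K : fieldType) (U V W : lmodType K) (b : U -> V -> W)
  (t : tens U V) : W := \sum_(p <- repr t) b p.1 p.2.

Section TensorTheory.
Variable K : fieldType.

Lemma linearP0 (U V : lmodType K) (f : U -> V) : linear f -> f 0 = 0.
Proof. by move=> fl; have := fl (-1) 0 0; rewrite scaler0 addr0 scaleN1r addNr. Qed.
Lemma linearPD (U V : lmodType K) (f : U -> V) :
  linear f -> {morph f : x y / x + y}.
Proof. by move=> fl x y; have := fl 1 x y; rewrite !scale1r. Qed.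
Lemma linearPZ (U V : lmodType K) (f : U -> V) :
  linear f -> forall a x, f (a *: x) = a *: f x.
Proof. by move=> fl a x; have := fl a x 0; rewrite (linearP0 fl) !addr0. Qed.
Lemma linearP_sum (U V : lmodType K) (f : U -> V) (I : Type) (r : seq I) (F : I -> U) :
  linear f -> f (\sum_(i <- r) F i) = \sum_(i <- r) f (F i).
Proof. by move=> fl; apply: big_morph; [exact: linearPD|exact: linearP0]. Qed.

Lemma tens_rel_sum (U V W : lmodType K) (b : U -> V -> W) :
  bilinear_for *:%R *:%R b -> forall s t, tens_rel s t ->
  \sum_(p <- s) b p.1 p.2 = \sum_(p <- t) b p.1 p.2.
Proof.
move=> [bl br] s t; elim=> {s t}.
- by [].
- by move=> s t _ ->.
- by move=> s t r _ -> _ ->.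
- by move=> s s' t t' _ h1 _ h2; rewrite !big_cat h1 h2.
- by move=> s t; rewrite !big_cat /= addrC.
- by move=> v; rewrite big_nil big_seq1 /= (linearP0 (bl v)).
- by move=> u u' v; rewrite !big_cons big_nil /= !addr0 (linearPD (bl v)).
- by move=> u v v'; rewrite !big_cons big_nil /= !addr0 (linearPD (br u)).
- move=> a u v; rewrite !big_seq1 /=.
  by rewrite (linearPZ (bl v)) (linearPZ (br u)).
Qed.

Section Lift.
Variables (U V W : lmodType K) (b : U -> V -> W).
Hypothesis bP : bilinear_for *:%R *:%R b.

Lemma tlift_pure u v : tlift b (u \ox v) = b u v.
Proof. by rewrite /tlift (tens_rel_sum bP (tens_repr _)) big_seq1. Qed.

Lemma tlift_linear : linear (tlift b).
Proof.
move=> a s t.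
have -> : a *: s + t = \pi_(tens U V) (tens_scaleseq a (repr s) ++ repr t).
  by rewrite [t in LHS]tens_clsE; exact: tensDE.
rewrite /tlift (tens_rel_sum bP (tens_repr _)) big_cat /=; congr (_ + _).
rewrite big_map scaler_sumr /=.
by apply: eq_bigr => -[u v] _ /=; rewrite (linearPZ (bP.1 v)).
Qed.

End Lift.

Lemma tens_ind (U V : lmodType K) (P : tens U V -> Prop) :
  (forall u v, P (u \ox v)) -> P 0 -> (forall s t, P s -> P t -> P (s + t)) ->
  forall t, P t.
Proof.
move=> h1 h0 hD t; rewrite [t]tens_sumE.
by elim/big_ind: _ => // -[u v] _; apply: h1.
Qed.

End TensorTheory.

Section TensorMaps.
Variable K : fieldType.

Definition tmap (U V U' V' : lmodType K) (f : U -> U') (g : V -> V') :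
  tens U V -> tens U' V' := tlift (fun u v => f u \ox g v).

Definition tmap2 (U V U' V' U'' V'' : lmodType K)
    (m : U -> U' -> U'') (n : V -> V' -> V'') (s : tens U V) (t : tens U' V') :
  tens U'' V'' :=
  tlift (fun u v => tlift (fun u' v' => m u u' \ox n v v') t) s.

Section Theory.
Variables (U V U' V' U'' V'' : lmodType K).
Variables (m : U -> U' -> U'') (n : V -> V' -> V'').
Hypotheses (mP : bilinear_for *:%R *:%R m) (nP : bilinear_for *:%R *:%R n).

Lemma tmap2_subproof u v :
  bilinear_for *:%R *:%R (fun u' v' => m u u' \ox n v v').
Proof.
have [pl pr] := tpure_bilinear U'' V''; split=> [v'|u'] a x y /=.
  by rewrite (mP.2 u) (pl _ a).
by rewrite (nP.2 v) (pr _ a).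
Qed.

Lemma tmap2_bilinear_subproof t : bilinear_for *:%R *:%R
  (fun u v => tlift (fun u' v' => m u u' \ox n v v') t).
Proof.
have [pl pr] := tpure_bilinear U'' V''; split=> [v|u] a x y /=.
  rewrite /tlift scaler_sumr -big_split /=; apply: eq_bigr => p _.
  by rewrite (mP.1 p.1) (pl _ a).
rewrite /tlift scaler_sumr -big_split /=; apply: eq_bigr => p _.
by rewrite (nP.1 p.2) (pr _ a).
Qed.

Lemma tmap2_pure u v u' v' :
  tmap2 m n (u \ox v) (u' \ox v') = m u u' \ox n v v'.
Proof.
rewrite /tmap2 tlift_pure; last exact: tmap2_bilinear_subproof.
by rewrite tlift_pure //; exact: tmap2_subproof.
Qed.

Lemma tmap2_bilinear : bilinear_for *:%R *:%R (tmap2 m n).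
Proof.
split=> [t|s] a x y /=.
  by rewrite /tmap2 tlift_linear //; exact: tmap2_bilinear_subproof.
rewrite /tmap2 {1 3 5}/tlift scaler_sumr -big_split /=.
by apply: eq_bigr => p _; rewrite tlift_linear //; exact: tmap2_subproof.
Qed.

End Theory.
End TensorMaps.

Record subspace (K : fieldType) (V : lmodType K) := Subspace {
  subspace_set :> V -> Prop;
  subspace0 : subspace_set 0;
  subspaceL : forall a x y, subspace_set x -> subspace_set y ->
    subspace_set (a *: x + y) }.

Section Carrier.
Variables (K : fieldType) (V : lmodType K) (S : subspace V).

Definition subspace_mem : {pred V} := fun x => `[< S x >].

Lemma subspace_memP : submod_closed subspace_mem.
Proof.
split=> [|a x y]; first by apply/asboolP/subspace0.
by move=> /asboolP xS /asboolP yS; apply/asboolP/subspaceL.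
Qed.

HB.instance Definition _ :=
  GRing.isSubmodClosed.Build K V subspace_mem subspace_memP.

Record carrier := Carrier { cval : V; _ : cval \in subspace_mem }.
HB.instance Definition _ := [isSub for cval].
HB.instance Definition _ := [Choice of carrier by <:].
HB.instance Definition _ := [SubChoice_isSubLmodule of carrier by <:].

Lemma cvalP (x : carrier) : S (cval x).
Proof. by case: x => x /= /asboolP. Qed.

Definition in_carrier (x : V) (xS : S x) : carrier :=
  Carrier (asboolT xS : x \in subspace_mem).

Lemma subspaceD x y : S x -> S y -> S (x + y).
Proof. by move=> xS yS; rewrite -[x]scale1r; apply: subspaceL. Qed.
Lemma subspaceZ a x : S x -> S (a *: x).
Proof. by move=> xS; rewrite -[_ *: _]addr0; apply: subspaceL => //; apply: subspace0. Qed.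
Lemma subspace_sum (I : Type) (r : seq I) (F : I -> V) :
  (forall i, S (F i)) -> S (\sum_(i <- r) F i).
Proof. by move=> FS; elim/big_ind: _ => //; [exact: subspace0|exact: subspaceD]. Qed.

End Carrier.

Definition full_subspace (K : fieldType) (V : lmodType K) : subspace V :=
  @Subspace K V setT I (fun _ _ _ _ _ => I).

Section TensorSubspace.
Variables (K : fieldType) (U V : lmodType K) (A : subspace U) (B : subspace V).

(* The image of A (x) B in U (x) V; over a field the map is injective, so this
   is A (x) B itself. *)
Definition tens_sub_set (t : tens U V) : Prop := exists s : seq (U * V),
  (forall p, p \in s -> A p.1 /\ B p.2) /\ t = \sum_(p <- s) p.1 \ox p.2.

Lemma tens_sub0 : tens_sub_set 0.
Proof. by exists [::]; rewrite big_nil. Qed.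

Lemma tens_subL a x y :
  tens_sub_set x -> tens_sub_set y -> tens_sub_set (a *: x + y).
Proof.
move=> [s [sP ->]] [t [tP ->]].
exists ([seq (a *: p.1, p.2) | p <- s] ++ t); split.
  move=> p; rewrite mem_cat => /orP[/mapP[q /sP[qA qB] -> /=]|/tP //].
  by split=> //; apply: subspaceZ.
rewrite big_cat /= big_map scaler_sumr; congr (_ + _); apply: eq_bigr => p _ /=.
by rewrite (linearPZ ((tpure_bilinear U V).1 p.2)).
Qed.

Definition tens_sub : subspace (tens U V) := Subspace tens_sub0 tens_subL.

Lemma tens_subD x y : tens_sub_set x -> tens_sub_set y -> tens_sub_set (x + y).
Proof. exact: (@subspaceD _ _ tens_sub). Qed.

Lemma tens_sub_pure u v : A u -> B v -> tens_sub (u \ox v).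
Proof.
move=> uA vB; exists [:: (u, v)]; split; last by rewrite big_seq1.
by move=> p; rewrite inE => /eqP ->.
Qed.

Lemma tens_sub_ind (P : tens U V -> Prop) :
  (forall u v, A u -> B v -> P (u \ox v)) -> P 0 ->
  (forall s t, P s -> P t -> P (s + t)) -> forall t, tens_sub t -> P t.
Proof.
move=> h1 h0 hD t [s [sP ->]]; rewrite big_seq.
by elim/big_ind: _ => // p /sP[]; apply: h1.
Qed.

End TensorSubspace.

(* m restricts to a product on A *)
Definition mul_closed (K : fieldType) (V : lmodType K) (m : V -> V -> V) (A : V -> Prop) :=
  forall x y, A x -> A y -> A (m x y).

Lemma tens_sub_closed (K : fieldType) (U V : lmodType K)
    (m : U -> U -> U) (n : V -> V -> V) (A : subspace U) (B : subspace V) :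
  bilinear_for *:%R *:%R m -> bilinear_for *:%R *:%R n ->
  mul_closed m A -> mul_closed n B -> mul_closed (tmap2 m n) (tens_sub A B).
Proof.
move=> mP nP mA nB x y; have [bl br] := tmap2_bilinear mP nP.
move=> xS yS; move: x xS; apply: tens_sub_ind.
- move=> u v uA vB; move: y yS; apply: tens_sub_ind.
  + move=> u' v' uA' vB'; rewrite tmap2_pure //.
    by apply: tens_sub_pure; [exact: mA|exact: nB].
  + by rewrite (linearP0 (br _)); apply: subspace0.
  + by move=> s t; rewrite (linearPD (br _)); apply: subspaceD.
- by rewrite (linearP0 (bl _)); apply: subspace0.
- by move=> s t; rewrite (linearPD (bl _)); apply: subspaceD.
Qed.

Section DgSpaces.
Variable K : fieldType.

(* Data of a dg vector space V = (+)_n V^n, cohomologically graded; the grading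
   is given by the projections [dg_part n] onto V^n.  The axioms are in
   [is_dg_space] (and [is_dg_lie] for [dgl_data]). *)
Record dg_data := DgData {
  dg_sort :> lmodType K;
  dg_part : int -> dg_sort -> dg_sort;
  dg_d : dg_sort -> dg_sort }.

Definition homog (V : dg_data) (n : int) (x : V) : Prop := dg_part n x = x.

Definition degree_map (V W : dg_data) (k : int) (f : V -> W) : Prop :=
  linear f /\ forall n x, f (dg_part n x) = dg_part (n + k) (f x).

Record is_dg_space (V : dg_data) : Prop := {
  dg_part_linear : forall n, linear (@dg_part V n);
  dg_part_proj : forall m n (x : V),
    dg_part m (dg_part n x) = if m == n then dg_part n x else 0;
  dg_part_sum : forall x : V,
    exists2 s : seq int, uniq s & x = \sum_(n <- s) dg_part n x;
  dg_d_degree : degree_map 1 (@dg_d V);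
  dg_d_d : forall x : V, dg_d (dg_d x) = 0 }.

Definition cochain_map (V W : dg_data) (f : V -> W) : Prop :=
  degree_map 0 f /\ forall x, f (dg_d x) = dg_d (f x).

Definition ksign (n : int) : K := (-1) ^+ `|n|%N.

(* For maps f, g of degree k; the boundary of h in the Hom complex is
   d h - (-1)^|h| h d with |h| = k - 1. *)
Definition homotopic (V W : dg_data) (k : int) (f g : V -> W) : Prop :=
  exists h : V -> W, degree_map (k - 1) h /\
    forall x, f x - g x = dg_d (h x) + ksign k *: h (dg_d x).

Definition homotopy_equivalence (V W : dg_data) (f : V -> W) : Prop :=
  cochain_map f /\ exists g : W -> V,
    [/\ cochain_map g, homotopic 0 (g \o f) id & homotopic 0 (f \o g) id].

(* s^{-n} K *)
Definition dg_line (n : int) : dg_data :=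
  @DgData K^o (fun k c => if k == n then c else 0) (fun=> 0).

Definition dg_sum (V W : dg_data) : dg_data :=
  @DgData (V * W)%type (fun n x => (dg_part n x.1, dg_part n x.2))
    (fun x => (dg_d x.1, dg_d x.2)).

(* x |-> (-1)^|x| x *)
Definition dg_sign (V : dg_data) (x : V) : V :=
  \sum_(n \in [set: int]) ksign n *: dg_part n x.

(* d (x (x) y) = dx (x) y + (-1)^|x| x (x) dy *)
Definition dg_tens (V W : dg_data) : dg_data :=
  @DgData (tens V W)
    (fun n => tlift (fun x y =>
       \sum_(i \in [set: int]) dg_part i x \ox dg_part (n - i) y))
    (tlift (fun x y => dg_d x \ox y + dg_sign x \ox dg_d y)).

End DgSpaces.

Section DgLie.
Variable K : fieldType.

Record dgl_data := DglData {
  dgl_space :> dg_data K;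
  dgl_br : dgl_space -> dgl_space -> dgl_space }.

Record is_dg_lie (a : dgl_data) : Prop := {
  dgl_is_dg_space : is_dg_space a;
  dgl_br_bilinear : bilinear_for *:%R *:%R (@dgl_br a);
  dgl_br_degree : forall i j (x y : a), homog i x -> homog j y ->
    homog (i + j) (dgl_br x y);
  dgl_br_anti : forall i j (x y : a), homog i x -> homog j y ->
    dgl_br x y = - (ksign K (i * j) *: dgl_br y x);
  dgl_br_jacobi : forall i j k (x y z : a),
    homog i x -> homog j y -> homog k z ->
    dgl_br x (dgl_br y z) =
      dgl_br (dgl_br x y) z + ksign K (i * j) *: dgl_br y (dgl_br x z);
  dgl_br_leibniz : forall i (x y : a), homog i x ->
    dg_d (dgl_br x y) = dgl_br (dg_d x) y + ksign K i *: dgl_br x (dg_d y) }.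

Definition dg_lie_map (a b : dgl_data) (f : a -> b) : Prop :=
  cochain_map f /\ forall x y, f (dgl_br x y) = dgl_br (f x) (f y).

(* The pairing <x|y> is pr (x \ox y), with pr a map out of a (x) a. *)
Record homotopy_manin_triple (a ap am : dgl_data) (ip : ap -> a) (im : am -> a)
    (n : int) (pr : dg_tens a a -> dg_line K n) : Prop := {
  hmt_a : is_dg_lie a;
  hmt_ap : is_dg_lie ap;
  hmt_am : is_dg_lie am;
  hmt_ip : dg_lie_map ip;
  hmt_im : dg_lie_map im;
  hmt_pr : cochain_map pr;
  hmt_sum : homotopy_equivalence
    ((fun x => ip x.1 + im x.2) : dg_sum ap am -> a);
  hmt_sym : forall i j (x y : a), homog i x -> homog j y ->
    pr (x \ox y) = ksign K (i * j) *: pr (y \ox x);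
  hmt_inv : forall i j k (x y z : a), homog i x -> homog j y -> homog k z ->
    pr (dgl_br x y \ox z) + ksign K (i * j) *: pr (y \ox dgl_br x z) = 0;
  hmt_inv_d : forall i j (x y : a), homog i x -> homog j y ->
    pr (dg_d x \ox y) + ksign K i *: pr (x \ox dg_d y) = 0;
  hmt_nondeg : forall i (x : a), homog i x -> dg_d x = 0 ->
    homotopic i ((fun y => pr (x \ox y)) : a -> dg_line K n) (fun=> 0) ->
    exists y : a, x = dg_d y;
  hmt_isop : homotopic 0
    ((fun t => pr (tmap ip ip t)) : dg_tens ap ap -> dg_line K n) (fun=> 0);
  hmt_isom : homotopic 0
    ((fun t => pr (tmap im im t)) : dg_tens am am -> dg_line K n) (fun=> 0) }.

Section Restrict.
Variables (a : dgl_data) (S : subspace a).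
Hypotheses (S_part : forall n x, S x -> S (dg_part n x))
  (S_d : forall x, S x -> S (dg_d x)) (S_br : mul_closed (@dgl_br a) S).

(* The dg Lie subalgebra S of a *)
Definition dgl_restrict : dgl_data :=
  @DglData
    (@DgData K (carrier S) (fun n x => in_carrier (S_part n (cvalP x)))
       (fun x => in_carrier (S_d (cvalP x))))
    (fun x y => in_carrier (S_br (cvalP x) (cvalP y))).

End Restrict.
End DgLie.

Arguments homotopy_manin_triple {K} a ap am ip im n pr.

Section Laurent.
Variable K : fieldType.

Definition laurent_set (u : int -> K^o) : Prop :=
  exists N : int, forall k, (k < N)%R -> u k = 0.

Lemma laurent_set0 : laurent_set 0.
Proof. by exists 0. Qed.

Lemma laurent_setL a u v :
  laurent_set u -> laurent_set v -> laurent_set (a *: u + v).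
Proof.
move=> [M uM] [N vN]; exists (Order.min M N) => k; rewrite lt_min.
move=> /andP[/uM uk /vN vk].
by change (a * u k + v k = 0); rewrite uk vk mulr0 addr0.
Qed.

Definition laurent_subspace : subspace (int -> K^o) :=
  Subspace laurent_set0 laurent_setL.

(* K((t)) *)
Definition laurent := carrier laurent_subspace.
HB.instance Definition _ := GRing.Lmodule.on laurent.

Definition lcoef (u : laurent) : int -> K := cval u.

Lemma lcoef_bound (u : laurent) : exists N : int, forall k, (k < N)%R -> lcoef u k = 0.
Proof. exact: (cvalP (u : carrier laurent_subspace)). Qed.

Lemma lcoefL a (u v : laurent) k : lcoef (a *: u + v) k = a * lcoef u k + lcoef v k.
Proof. by []. Qed.

Lemma laurent_ext (u v : laurent) : lcoef u =1 lcoef v -> u = v.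
Proof. by move=> uv; apply: val_inj; apply/funext. Qed.

Definition lmul_coef (u v : laurent) (k : int) : K :=
  \sum_(i \in [set: int]) lcoef u i * lcoef v (k - i).

Lemma lmul_set u v : laurent_set (lmul_coef u v).
Proof.
have [M uM] := lcoef_bound u; have [N vN] := lcoef_bound v.
exists (M + N) => k kMN; rewrite /lmul_coef fsbig1 // => i _.
have [/uM ->|Mi] := ltP i M; first by rewrite mul0r.
rewrite vN ?mulr0 // ltrBlDl (lt_le_trans kMN) //.
by rewrite lerD2r.
Qed.

Definition lmul (u v : laurent) : laurent :=
  in_carrier (S := laurent_subspace) (lmul_set u v).

Lemma finite_int_itv (M N : int) : finite_set [set i : int | (M <= i < N)%R].
Proof.
apply: (@sub_finite_set _ _ ((fun n : nat => M + n%:Z) @` `I_(`|N - M|)%N)).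
  move=> i /= /andP[Mi iN]; exists `|i - M|%N.
    rewrite -ltz_nat !gez0_abs ?subr_ge0 //.
      by rewrite ltrD2r.
    by apply: ltW; apply: le_lt_trans iN.
  by rewrite gez0_abs ?subr_ge0 //; exact: subrKC.
by apply: finite_image; apply: finite_II.
Qed.

Lemma lmul_finite u v k : finite_set
  ([set: int] `&` (fun i => lcoef u i * lcoef v (k - i)) @^-1` [set~ 0]).
Proof.
have [M uM] := lcoef_bound u; have [N vN] := lcoef_bound v.
apply: sub_finite_set (finite_int_itv M (k - N + 1)) => i [_ /= ne0].
apply/andP; split.
  rewrite leNgt; apply/negP => /uM u0; apply: ne0.
  by rewrite u0 mul0r.
rewrite ltzD1 lerBrDl -lerBrDr leNgt.
by apply/negP => /vN v0; apply: ne0; rewrite v0 mulr0.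
Qed.

Lemma fsumL (a : K) (f g : int -> K) :
  finite_set ([set: int] `&` f @^-1` [set~ 0]) ->
  finite_set ([set: int] `&` g @^-1` [set~ 0]) ->
  \sum_(i \in [set: int]) (a * f i + g i) =
  a * (\sum_(i \in [set: int]) f i) + \sum_(i \in [set: int]) g i.
Proof.
rewrite !setTI => fF gF.
have fgF : finite_set (f @^-1` [set~ 0] `|` g @^-1` [set~ 0]) by rewrite finite_setU.
pose X := fset_set (f @^-1` [set~ 0] `|` g @^-1` [set~ 0]).
have XP i : i \notin X -> f i = 0 /\ g i = 0.
  rewrite in_fset_set // => /negP; rewrite inE /= => /not_orP[].
  by move=> /contrapT -> /contrapT ->.
rewrite !(fsbigTE X); first by rewrite big_split /= mulr_sumr.
all: by move=> i /XP[h1 h2]; rewrite ?h1 ?h2 ?mulr0 ?addr0.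
Qed.

Lemma lmul_bilinear : bilinear_for *:%R *:%R lmul.
Proof.
split=> [v|u] a x y; apply: laurent_ext => k; rewrite lcoefL /lcoef /= /lmul_coef.
  rewrite -fsumL; [|exact: lmul_finite..].
  by apply: eq_fsbigr => i _; rewrite lcoefL mulrDl mulrA.
rewrite -fsumL; [|exact: lmul_finite..].
by apply: eq_fsbigr => i _; rewrite lcoefL mulrDr mulrCA.
Qed.

Definition res (u : laurent) : K := lcoef u (-1).

(* K[[t]] *)
Definition power_series : subspace laurent.
Proof.
refine (@Subspace K laurent (fun u => forall k, (k < 0)%R -> lcoef u k = 0) _ _).
  by [].
by move=> a u v u0 v0 k k0; rewrite lcoefL u0 // v0 // mulr0 addr0.
Defined.

(* t^{-1} K[t^{-1}]: a Laurent series has finitely many negative terms *)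
Definition polar_part : subspace laurent.
Proof.
refine (@Subspace K laurent (fun u => forall k, (0 <= k)%R -> lcoef u k = 0) _ _).
  by [].
by move=> a u v u0 v0 k k0; rewrite lcoefL u0 // v0 // mulr0 addr0.
Defined.

Lemma power_series_closed : mul_closed lmul power_series.
Proof.
move=> u v u0 v0 k k0; rewrite /lcoef /= /lmul_coef fsbig1 // => i _.
have [/u0 ->|Mi] := ltP i 0; first by rewrite mul0r.
by rewrite v0 ?mulr0 // ltrBlDl (lt_le_trans k0) ?addr0.
Qed.

Lemma polar_part_closed : mul_closed lmul polar_part.
Proof.
move=> u v u0 v0 k k0; rewrite /lcoef /= /lmul_coef fsbig1 // => i _.
have [/u0 ->|Mi] := leP 0 i; first by rewrite mul0r.
by rewrite v0 ?mulr0 // subr_ge0 (le_trans _ k0) ?ltW.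
Qed.

(* K((w)) (x) K((z)), with w the variable of the left factor *)
Definition ringB := tens laurent laurent.
HB.instance Definition _ := GRing.Lmodule.on ringB.

Definition Bmul : ringB -> ringB -> ringB := tmap2 lmul lmul.

Definition res_wz (b : ringB) : K := tlift (fun u v => (res u * res v : K^o)) b.

End Laurent.

Record lie_algebra (K : fieldType) := LieAlgebra {
  lie_sort :> vectType K;
  lie_br : lie_sort -> lie_sort -> lie_sort;
  lie_bilinear : bilinear_for *:%R *:%R lie_br;
  lie_alternating : forall x, lie_br x x = 0;
  lie_jacobi : forall x y z,
    lie_br x (lie_br y z) + lie_br y (lie_br z x) + lie_br z (lie_br x y) = 0 }.

Definition lie_ideal (K : fieldType) (g : lie_algebra K) (I : {vspace g}) : Prop :=
  forall x y : g, y \in I -> lie_br x y \in I.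

Definition simple_lie (K : fieldType) (g : lie_algebra K) : Prop :=
  (exists x y : g, lie_br x y != 0) /\
  forall I : {vspace g}, lie_ideal I -> I = 0%VS \/ I = fullv.

Record invariant_form (K : fieldType) (g : lie_algebra K) (kappa : g -> g -> K) :
    Prop := {
  inv_form_bilinear : bilinear_for *%R *%R kappa;
  inv_form_sym : forall x y, kappa x y = kappa y x;
  inv_form_inv : forall x y z,
    kappa (lie_br x y) z + kappa y (lie_br x z) = 0;
  inv_form_nondeg : forall x, (forall y, kappa x y = 0) -> x = 0 }.

Section Polydisc.
Variables (K : fieldType) (g : lie_algebra K).

(* g (x) B and (g (x) B)[s] *)
Definition gB := tens g (ringB K).
HB.instance Definition _ := GRing.Lmodule.on gB.
Definition gBs := tens gB {poly K}.
HB.instance Definition _ := GRing.Lmodule.on gBs.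

Definition gB_br : gB -> gB -> gB := tmap2 (@lie_br K g) (@Bmul K).
Definition gBs_br : gBs -> gBs -> gBs := tmap2 gB_br *%R.

Definition ev (c : K) : gBs -> gB := tlift (fun (x : gB) (p : {poly K}) => p.[c] *: x).
Definition ds : gBs -> gBs := tmap id (@deriv K).
Definition const_s (x : gB) : gBs := x \ox (1 : {poly K}).

(* (f, F) stands for f(s) + F(s) ds. *)
Definition form := (gBs * gBs)%type.
HB.instance Definition _ := GRing.Lmodule.on form.

Definition form_part (n : int) (x : form) : form :=
  (if n == 0 then x.1 else 0, if n == 1 then x.2 else 0).
Definition form_d (x : form) : form := (0, ds x.1).
Definition form_br (x y : form) : form :=
  (gBs_br x.1 y.1, gBs_br x.1 y.2 + gBs_br x.2 y.1).

Definition form_pairs : dgl_data K :=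
  @DglData K
    (@DgData K (form * form)%type
       (fun n x => (form_part n x.1, form_part n x.2))
       (fun x => (form_d x.1, form_d x.2)))
    (fun x y => (form_br x.1 y.1, form_br x.2 y.2)).

Lemma poly_mul_bilinear : bilinear_for *:%R *:%R ( *%R : {poly K} -> _).
Proof.
split=> [p|p] a q r /=; first by rewrite mulrDl -scalerAl.
by rewrite mulrDr -scalerAr.
Qed.
Lemma Bmul_bilinear : bilinear_for *:%R *:%R (@Bmul K).
Proof. exact: tmap2_bilinear (@lmul_bilinear K) (@lmul_bilinear K). Qed.
Lemma gB_br_bilinear : bilinear_for *:%R *:%R gB_br.
Proof. exact: tmap2_bilinear (@lie_bilinear K g) Bmul_bilinear. Qed.
Lemma gBs_br_bilinear : bilinear_for *:%R *:%R gBs_br.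
Proof. exact: tmap2_bilinear gB_br_bilinear poly_mul_bilinear. Qed.

Lemma ev_bilinear c :
  bilinear_for *:%R *:%R (fun (x : gB) (p : {poly K}) => p.[c] *: x).
Proof.
split=> [p|x] a y z /=; first by rewrite scalerDr !scalerA mulrC.
by rewrite hornerD hornerZ scalerDl scalerA.
Qed.
Lemma ev_linear c : linear (ev c).
Proof. exact: tlift_linear (ev_bilinear c). Qed.
Lemma ev_pure c x p : ev c (x \ox p) = p.[c] *: x.
Proof. by rewrite /ev tlift_pure //; exact: ev_bilinear. Qed.
Lemma ev_const c x : ev c (const_s x) = x.
Proof. by rewrite ev_pure hornerC scale1r. Qed.

Lemma ev_br c x y : ev c (gBs_br x y) = gB_br (ev c x) (ev c y).
Proof.
have [bl br] := gBs_br_bilinear; have [cl cr] := gB_br_bilinear.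
have evl := ev_linear c.
elim/tens_ind: x => [u p||s t sP tP]; last 2 first.
- by rewrite (linearP0 (bl y)) !(linearP0 evl) (linearP0 (cl _)).
- by rewrite (linearPD (bl y)) !(linearPD evl) (linearPD (cl _)) sP tP.
elim/tens_ind: y => [v q||s t sP tP]; last 2 first.
- by rewrite (linearP0 (br _)) !(linearP0 evl) (linearP0 (cr _)).
- by rewrite (linearPD (br _)) !(linearPD evl) (linearPD (cr _)) sP tP.
rewrite /gBs_br tmap2_pure;
  [|exact: gB_br_bilinear|exact: poly_mul_bilinear].
by rewrite !ev_pure hornerM (linearPZ (cl _)) (linearPZ (cr _)) scalerA.
Qed.

Let L := full_subspace (laurent K).

(* g (x) K[[w]] (x) K((z)) *)
Definition gB_w : subspace gB :=
  tens_sub (full_subspace g) (tens_sub (power_series K) L).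
(* g (x) K((w)) (x) K[[z]] *)
Definition gB_z : subspace gB :=
  tens_sub (full_subspace g) (tens_sub L (power_series K)).
(* g (x) K[[w]] (x) K[[z]] *)
Definition gB_wz : subspace gB :=
  tens_sub (full_subspace g) (tens_sub (power_series K) (power_series K)).
(* g (x) w^{-1} z^{-1} K[w^{-1}, z^{-1}] *)
Definition gB_polar : subspace gB :=
  tens_sub (full_subspace g) (tens_sub (polar_part K) (polar_part K)).
Definition gBs_polar : subspace gBs :=
  tens_sub gB_polar (full_subspace {poly K}).

Local Ltac sub0 := first [exact: subspace0 | exact: tens_sub0].
Local Ltac subL := first [exact: subspaceL | exact: tens_subL].

Lemma gB_closed (S T : subspace (laurent K)) :
  mul_closed (@lmul K) S -> mul_closed (@lmul K) T ->
  mul_closed gB_br (tens_sub (full_subspace g) (tens_sub S T)).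
Proof.
move=> Sc Tc; apply: tens_sub_closed; [exact: lie_bilinear|exact: Bmul_bilinear|by []|].
by apply: tens_sub_closed => //; exact: lmul_bilinear.
Qed.

Lemma gBs_polar_closed : mul_closed gBs_br gBs_polar.
Proof.
apply: tens_sub_closed; [exact: gB_br_bilinear|exact: poly_mul_bilinear| |by []].
by apply: gB_closed; exact: polar_part_closed.
Qed.

Lemma ds_polar x : gBs_polar x -> gBs_polar (ds x).
Proof.
have bP : bilinear_for *:%R *:%R (fun (u : gB) (p : {poly K}) => u \ox p^`()).
  have [pl pr] := tpure_bilinear gB {poly K}.
  by split=> [p|u] a y z /=; [exact: pl|rewrite derivD derivZ; exact: pr].
have dl := tlift_linear bP.
move: x; apply: tens_sub_ind => [u v uS _||s t sS tS].
- by rewrite /ds /tmap tlift_pure //; apply: tens_sub_pure.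
- by rewrite /ds /tmap (linearP0 dl); apply: subspace0.
- by rewrite /ds /tmap (linearPD dl); apply: subspaceD.
Qed.

Record punctured_cond (x : form * form) : Prop := {
  pc_glue : ev 1 x.1.1 = ev 1 x.2.1;
  pc_w : gB_w (ev 0 x.1.1);
  pc_z : gB_z (ev 0 x.2.1) }.

Lemma punctured0 : punctured_cond 0.
Proof. by split; rewrite /= !(linearP0 (ev_linear _)) //; sub0. Qed.
Lemma puncturedL a x y :
  punctured_cond x -> punctured_cond y -> punctured_cond (a *: x + y).
Proof.
move=> [x1 x2 x3] [y1 y2 y3]; split; rewrite /= !ev_linear.
- by rewrite x1 y1.
- subL.
- subL.
Qed.
Definition punctured_subspace : subspace form_pairs :=
  @Subspace K form_pairs punctured_cond punctured0 puncturedL.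

Lemma punctured_part n (x : form_pairs) :
  punctured_subspace x -> punctured_subspace (dg_part n x).
Proof.
move=> [x1 x2 x3]; split; rewrite /=; case: (n == 0) => //;
  rewrite ?(linearP0 (ev_linear _)) //; sub0.
Qed.
Lemma punctured_d (x : form_pairs) :
  punctured_subspace x -> punctured_subspace (dg_d x).
Proof.
by move=> _; split; rewrite /= !(linearP0 (ev_linear _)) //; sub0.
Qed.
Lemma punctured_br : mul_closed (@dgl_br K form_pairs) punctured_subspace.
Proof.
move=> x y [x1 x2 x3] [y1 y2 y3]; split; rewrite /= !ev_br.
- by rewrite x1 y1.
- by apply: gB_closed => //; exact: power_series_closed.
- by apply: gB_closed => //; exact: power_series_closed.
Qed.

Definition g_Dx : dgl_data K :=
  dgl_restrict punctured_part punctured_d punctured_br.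

Record minus_cond (x : form * form) : Prop := {
  mc_f : gBs_polar x.1.1;
  mc_F : gBs_polar x.1.2;
  mc_g : gBs_polar x.2.1;
  mc_G : gBs_polar x.2.2;
  mc_glue : ev 1 x.1.1 = ev 1 x.2.1;
  mc_f0 : ev 0 x.1.1 = 0;
  mc_g0 : ev 0 x.2.1 = 0 }.

Lemma minus0 : minus_cond 0.
Proof. by split; rewrite /= ?(linearP0 (ev_linear _)) //; sub0. Qed.
Lemma minusL a x y : minus_cond x -> minus_cond y -> minus_cond (a *: x + y).
Proof.
move=> [x1 x2 x3 x4 x5 x6 x7] [y1 y2 y3 y4 y5 y6 y7].
split; rewrite /= ?ev_linear; try subL.
- by rewrite x5 y5.
- by rewrite x6 y6 scaler0 addr0.
- by rewrite x7 y7 scaler0 addr0.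
Qed.
Definition minus_subspace : subspace form_pairs :=
  @Subspace K form_pairs minus_cond minus0 minusL.

Lemma minus_part n (x : form_pairs) : minus_subspace x -> minus_subspace (dg_part n x).
Proof.
move=> [x1 x2 x3 x4 x5 x6 x7]; split; rewrite /=;
  try case: (n == 0) => //; try case: (n == 1) => //;
  rewrite ?(linearP0 (ev_linear _)) //; sub0.
Qed.
Lemma minus_d (x : form_pairs) : minus_subspace x -> minus_subspace (dg_d x).
Proof.
move=> [x1 x2 x3 x4 x5 x6 x7]; split; rewrite /= ?(linearP0 (ev_linear _)) //;
  try sub0; exact: ds_polar.
Qed.
Lemma minus_br : mul_closed (@dgl_br K form_pairs) minus_subspace.
Proof.
move=> x y [x1 x2 x3 x4 x5 x6 x7] [y1 y2 y3 y4 y5 y6 y7].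
have cl := gBs_polar_closed.
split; rewrite /= ?ev_br; try exact: cl; try by apply: tens_subD; exact: cl.
- by rewrite x5 y5.
- by rewrite x6 (linearP0 (gB_br_bilinear.1 _)).
- by rewrite x7 (linearP0 (gB_br_bilinear.1 _)).
Qed.

Definition g_minus : dgl_data K := dgl_restrict minus_part minus_d minus_br.

(* g (x) B as a dg Lie algebra in degree 0 *)
Definition gB_dgl : dgl_data K :=
  @DglData K (@DgData K gB (fun n x => if n == 0 then x else 0) (fun=> 0)) gB_br.

Lemma plus_part n (x : gB_dgl) : gB_wz x -> gB_wz (dg_part n x).
Proof. by move=> xS; rewrite /=; case: (n == 0) => //; sub0. Qed.
Lemma plus_d (x : gB_dgl) : gB_wz x -> gB_wz (dg_d x).
Proof. by move=> _; sub0. Qed.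
Lemma plus_br : mul_closed (@dgl_br K gB_dgl) gB_wz.
Proof. by apply: gB_closed; exact: power_series_closed. Qed.

Definition g_plus : dgl_data K :=
  dgl_restrict (a := gB_dgl) plus_part plus_d plus_br.

Lemma tens_subS (U V : lmodType K) (A A' : subspace U) (C C' : subspace V) t :
  (forall u, A u -> A' u) -> (forall v, C v -> C' v) ->
  tens_sub A C t -> tens_sub A' C' t.
Proof.
move=> AA CC [s [sP ->]]; exists s; split=> // p /sP[pA pC].
by split; [exact: AA|exact: CC].
Qed.

Definition const_pair (x : gB) : form_pairs := ((const_s x, 0), (const_s x, 0)).

Lemma plus_punctured (x : g_plus) : punctured_subspace (const_pair (cval x)).
Proof.
have xS : gB_wz (cval x) := cvalP x.
split; rewrite /= !ev_const //; apply: tens_subS xS => // u; exact: tens_subS.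
Qed.

Definition i_plus (x : g_plus) : g_Dx := in_carrier (plus_punctured x).

Lemma minus_punctured (x : g_minus) : punctured_subspace (cval x : form_pairs).
Proof.
have [_ _ _ _ xg x0 x1] : minus_subspace (cval x) := cvalP x.
by split=> //; rewrite ?x0 ?x1; sub0.
Qed.

Definition i_minus (x : g_minus) : g_Dx := in_carrier (minus_punctured x).

Section Pairing.
Variable kappa : g -> g -> K.

(* a (x) b, a' (x) b' |-> kappa(a|a') b b', extended to polynomials in s *)
Definition kappa_B (x y : gB) : ringB K :=
  tlift (fun a b => tlift (fun a' b' => kappa a a' *: Bmul b b') y) x.
Definition kappa_Bs : gBs -> gBs -> tens (ringB K) {poly K} := tmap2 kappa_B *%R.

(* the B[s]-valued coefficient of ds in kappa(x /\ y) *)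
Definition kappa_wedge1 (x y : form) : tens (ringB K) {poly K} :=
  kappa_Bs x.1 y.2 + kappa_Bs x.2 y.1.

Definition res_wz_s : tens (ringB K) {poly K} -> {poly K} :=
  tlift (fun b p => res_wz b *: p).

(* \int_0^1 p(s) ds *)
Definition int01 (p : {poly K}) : K := \sum_(i < size p) p`_i / i.+1%:R.

Definition pairing_form (x y : form * form) : K :=
  2^-1 * (int01 (res_wz_s (kappa_wedge1 x.1 y.1)) -
          int01 (res_wz_s (kappa_wedge1 x.2 y.2))).

Definition pairing : dg_tens g_Dx g_Dx -> dg_line K 1 :=
  tlift (fun x y : g_Dx => (pairing_form (cval x) (cval y) : K^o)).

End Pairing.
End Polydisc.

(* Main.v *)
Require Import Defs.
From mathcomp Require Import all_boot all_order all_algebra.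
From mathcomp Require Import finmap.
From mathcomp Require Import boolp classical_sets fsbigop.
From mathcomp Require Import reals complex.
From mathcomp Require Import ring.

(** Every Laurent series is uniquely a power series plus a polar part.  Applying
    this in w and in z splits g (x) K((w)) (x) K((z)) into four summands,
    [pow_pow], [pow_pol], [pol_pow] and [pol_pol] (first word: w, second: z).
    The subspace where w is regular is [pow_pow + pow_pol], the one where z is
    regular is [pow_pow + pol_pow], g_+ is [pow_pow], and g_- consists of forms
    with coefficients in [pol_pol].  Each axiom is read off this splitting.

    _Homotopy equivalence._  A retraction of g_+ (+) g_- into the big algebra is
    explicit ([retract]): to a pair of forms it associates the [pow_pow] part of
    the common value of the functions at s = 1, and the [pol_pol] part of all
    coefficients.  It is a strict left inverse of (i_+, i_-)
    ([retract_i_sum]).  In the other direction a one-form is integrated from the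
    gluing point s = 1, the [pol_pol] part is removed, and a constant common to
    both components is added; up to its [pow_pow] part that constant is forced by
    the regularity conditions at s = 0 ([contract_punctured]), and the resulting
    operator is a contracting homotopy ([contract_homotopy]).

    _Lie structure and pairing._  A Lie algebra tensored with a commutative
    algebra is a Lie algebra, and an invariant form tensored with multiplication
    remains invariant ([lie_bracket_tens], [inv_pairing_tens]); commutativity and
    associativity of the product of Laurent series come from polynomials
    ([lcoef_lmul]).  Compatibility of the pairing with the differential is
    Stokes' formula on the two intervals ([int_form_stokes]): the boundary terms
    at s = 1 cancel because the two functions agree there, and those at s = 0
    vanish because two series regular in the same variable have a product without
    residue.  Both g_+ and g_- are
    strictly isotropic: constants have no one-form part, and a product of two
    polar series has no term of degree -1.

    _Non-degeneracy._  If the pairing with a cocycle x is null-homotopic then x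
    pairs to zero with every cocycle.  Pairing x of degree 0, which is a constant,
    with one-forms gives x = 0 ([res_form_nondeg]).  Pairing x = (F ds, H ds)
    with g_+ shows that the [pol_pol] part of the integral of F - H vanishes
    ([res_form_nondeg_pol_pol]); the rest of that integral splits into a part
    regular in w and a part regular in z, which are the integration constants
    that turn primitives of F and H into an element of the algebra bounding x
    ([pairing_nondeg]).  Both facts use that an element of an algebraic tensor
    product is zero as soon as all its coefficients are
    ([tens_separated]). *)

Set Implicit Arguments.
Unset Strict Implicit.
Unset Printing Implicit Defensive.

Import Order.TTheory GRing.Theory Num.Theory.
Import Defs.
Local Open Scope ring_scope.
Local Open Scope complex_scope.

(** * Linear and bilinear maps on tensor products *)

Notation bil b := (bilinear_for *:%R *:%R b).

Section Linear.
Variables (K : fieldType) (U V W X : lmodType K).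
Implicit Types (f g : U -> V).

Lemma lin_id : linear (fun x : U => x).
Proof. by []. Qed.
Lemma lin_0 : linear (fun _ : U => 0 : V).
Proof. by move=> a x y; rewrite scaler0 addr0. Qed.
Lemma lin_add f g : linear f -> linear g -> linear (fun x => f x + g x).
Proof. by move=> fl gl a x y; rewrite fl gl scalerDr addrACA. Qed.
Lemma lin_opp f : linear f -> linear (fun x => - f x).
Proof. by move=> fl a x y; rewrite fl opprD scalerN. Qed.
Lemma lin_scale c f : linear f -> linear (fun x => c *: f x).
Proof. by move=> fl a x y; rewrite fl scalerDr !scalerA mulrC. Qed.
Lemma lin_comp (h : V -> W) f : linear h -> linear f -> linear (fun x => h (f x)).
Proof. by move=> hl fl a x y; rewrite fl hl. Qed.
Lemma lin_l (b : V -> X -> W) f y : bil b -> linear f -> linear (fun x => b (f x) y).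
Proof. by move=> [bl _] fl a x x'; rewrite fl (bl y). Qed.
Lemma lin_r (b : X -> V -> W) f y : bil b -> linear f -> linear (fun x => b y (f x)).
Proof. by move=> [_ br] fl a x x'; rewrite fl (br y). Qed.
Lemma linearPN f x : linear f -> f (- x) = - f x.
Proof. by move=> fl; rewrite -scaleN1r (linearPZ fl) scaleN1r. Qed.
Lemma linearPB f x y : linear f -> f (x - y) = f x - f y.
Proof. by move=> fl; rewrite (linearPD fl) linearPN. Qed.
End Linear.

Section Bilinear.
Variables (K : fieldType) (U V W : lmodType K) (b : U -> V -> W).
Hypothesis bP : bil b.
Lemma bil0l y : b 0 y = 0. Proof. exact: linearP0 (bP.1 y). Qed.
Lemma bil0r x : b x 0 = 0. Proof. exact: linearP0 (bP.2 x). Qed.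
Lemma bilDl x x' y : b (x + x') y = b x y + b x' y.
Proof. exact: linearPD (bP.1 y) x x'. Qed.
Lemma bilDr x y y' : b x (y + y') = b x y + b x y'.
Proof. exact: linearPD (bP.2 x) y y'. Qed.
Lemma bilZl a x y : b (a *: x) y = a *: b x y.
Proof. exact: linearPZ (bP.1 y) a x. Qed.
Lemma bilZr a x y : b x (a *: y) = a *: b x y.
Proof. exact: linearPZ (bP.2 x) a y. Qed.
Lemma bilNl x y : b (- x) y = - b x y.
Proof. by rewrite -scaleN1r bilZl scaleN1r. Qed.
Lemma bilNr x y : b x (- y) = - b x y.
Proof. by rewrite -scaleN1r bilZr scaleN1r. Qed.
End Bilinear.

(** The form in which multilinear identities are checked below: one variable at a
    time is replaced by a pure tensor. *)
Lemma tens_ext (K : fieldType) (U V W : lmodType K) (f g : tens U V -> W) :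
  linear f -> linear g -> (forall u v, f (u \ox v) = g (u \ox v)) ->
  forall t, f t = g t.
Proof.
move=> fl gl fg; apply: tens_ind => // [|s t IHs IHt].
  by rewrite (linearP0 fl) (linearP0 gl).
by rewrite (linearPD fl) (linearPD gl) IHs IHt.
Qed.

Section TensorMap.
Variables (K : fieldType) (U V U' V' : lmodType K) (f : U -> U') (g : V -> V').
Hypotheses (fl : linear f) (gl : linear g).
Lemma tmap_bil : bil (fun u v => f u \ox g v).
Proof.
have [pl pr] := tpure_bilinear U' V'.
by split=> [v|u] a x y /=; rewrite ?fl ?gl; [exact: pl|exact: pr].
Qed.
Lemma tmap_linear : linear (tmap f g).
Proof. exact: tlift_linear tmap_bil. Qed.
Lemma tmap_pure u v : tmap f g (u \ox v) = f u \ox g v.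
Proof. exact: tlift_pure tmap_bil u v. Qed.
End TensorMap.

(** With [mu := tpure] this is [tmap2], and with [mu := *:%R] it is [kappa_B],
    both by conversion; so one set of lemmas serves for both. *)
Definition tprod (K : fieldType) (U V U' V' M N P : lmodType K)
  (mu : M -> N -> P) (m : U -> U' -> M) (n : V -> V' -> N)
  (s : tens U V) (t : tens U' V') : P :=
  tlift (fun u v => tlift (fun u' v' => mu (m u u') (n v v')) t) s.

Section TensorProd.
Variables (K : fieldType) (U V U' V' M N P : lmodType K).
Variables (mu : M -> N -> P) (m : U -> U' -> M) (n : V -> V' -> N).
Hypotheses (muP : bil mu) (mP : bil m) (nP : bil n).

Lemma tprod_bil_r u v : bil (fun u' v' => mu (m u u') (n v v')).
Proof.
split=> [v'|u'] a x y /=.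
  by rewrite (mP.2 u) (muP.1 _ a).
by rewrite (nP.2 v) (muP.2 _ a).
Qed.
Lemma tprod_bil_l t : bil (fun u v => tlift (fun u' v' => mu (m u u') (n v v')) t).
Proof.
split=> [v|u] a x y /=; rewrite /tlift scaler_sumr -big_split /=;
  apply: eq_bigr => p _.
  by rewrite (mP.1 p.1) (muP.1 _ a).
by rewrite (nP.1 p.2) (muP.2 _ a).
Qed.
Lemma tprod_pure u v u' v' :
  tprod mu m n (u \ox v) (u' \ox v') = mu (m u u') (n v v').
Proof.
rewrite /tprod (tlift_pure (tprod_bil_l _)).
exact: (tlift_pure (tprod_bil_r u v)).
Qed.
Lemma tprod_bilinear : bil (tprod mu m n).
Proof.
split=> [t|s] a x y /=.
  exact: (tlift_linear (tprod_bil_l t)).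
rewrite /tprod {1 3 5}/tlift scaler_sumr -big_split /=; apply: eq_bigr => p _.
exact: (tlift_linear (tprod_bil_r p.1 p.2)).
Qed.
End TensorProd.

(** Proves linearity of a function in one of its arguments, from the
    (bi)linearity hypotheses present in the context. *)
Ltac lin := solve [ exact: lin_id | exact: lin_0 | assumption
  | apply: lin_add; lin | apply: lin_opp; lin | apply: lin_scale; lin
  | match goal with
    | H : bilinear_for _ _ ?b |- GRing.linear_for _ ?F =>
        lazymatch F with context [b] =>
          first [ exact: (H.1 _) | exact: (H.2 _)
                | apply: (lin_l _ H); lin | apply: (lin_r _ H); lin ] end
    | H : GRing.linear_for _ ?h |- GRing.linear_for _ ?F =>
        lazymatch F with context [h] => apply: (lin_comp H); lin end
    end ].

(** * Lie brackets, products and invariant pairings on tensor products *)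

(** The Jacobi identity is in Leibniz form, which is how it enters the graded
    identities. *)
Record lie_bracket (K : fieldType) (L : lmodType K) (b : L -> L -> L) : Prop := {
  lb_bil : bil b;
  lb_anti : forall x y, b x y = - b y x;
  lb_jacobi : forall x y z, b x (b y z) = b (b x y) z + b y (b x z) }.

Record comm_product (K : fieldType) (A : lmodType K) (m : A -> A -> A) : Prop := {
  cp_bil : bil m;
  cp_comm : commutative m;
  cp_assoc : associative m }.

Record inv_pairing (K : fieldType) (L M : lmodType K) (b : L -> L -> L)
    (q : L -> L -> M) : Prop := {
  ip_bil : bil q;
  ip_sym : forall x y, q x y = q y x;
  ip_inv : forall x y z, q (b x y) z + q y (b x z) = 0 }.

Section TensorStructures.
Variables (K : fieldType).

(** On pure tensors each identity is that of [b], tensored with one and the same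
    product of the right factors. *)
Lemma lie_bracket_tens (L A : lmodType K) (b : L -> L -> L) (m : A -> A -> A) :
  lie_bracket b -> comm_product m -> lie_bracket (tmap2 b m).
Proof.
move=> [bP ba bj] [mP mc ma]; have pP := tpure_bilinear L A.
have tP := tmap2_bilinear bP mP; have E := tmap2_pure bP mP; split=> //.
  move=> x y; move: x; apply: tens_ext => [||u v]; [by lin..|].
  move: y; apply: tens_ext => [||u' v']; [by lin..|].
  by rewrite !E ba mc (bilNl pP).
move=> x y z; move: x; apply: tens_ext => [||u v]; [by lin..|].
move: y; apply: tens_ext => [||u' v']; [by lin..|].
move: z; apply: tens_ext => [||u'' v'']; [by lin..|].
rewrite !E bj (bilDl pP) !ma; congr (_ + _ \ox _).
by rewrite (mc v').
Qed.

Lemma comm_product_tens (A B : lmodType K) (m : A -> A -> A) (n : B -> B -> B) :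
  comm_product m -> comm_product n -> comm_product (tmap2 m n).
Proof.
move=> [mP mc ma] [nP nc na].
have tP := tmap2_bilinear mP nP; have E := tmap2_pure mP nP; split=> //.
  move=> x y; move: x; apply: tens_ext => [||u v]; [by lin..|].
  move: y; apply: tens_ext => [||u' v']; [by lin..|].
  by rewrite !E mc nc.
move=> x y z; move: x; apply: tens_ext => [||u v]; [by lin..|].
move: y; apply: tens_ext => [||u' v']; [by lin..|].
move: z; apply: tens_ext => [||u'' v'']; [by lin..|].
by rewrite !E ma na.
Qed.

Lemma inv_pairing_tens (L A M N P : lmodType K) (mu : M -> N -> P)
    (b : L -> L -> L) (q : L -> L -> M) (m : A -> A -> A) (n : A -> A -> N) :
  bil b -> inv_pairing b q -> comm_product m -> bil n -> bil mu ->
  (forall x y, n x y = n y x) -> (forall x y z, n (m x y) z = n x (m y z)) ->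
  inv_pairing (tmap2 b m) (tprod mu q n).
Proof.
move=> bP [qP qs qi] [mP mc ma] nP muP ns ni.
have tP := tmap2_bilinear bP mP; have E := tmap2_pure bP mP.
have sP := tprod_bilinear muP qP nP; have F := tprod_pure muP qP nP; split=> //.
  move=> x y; move: x; apply: tens_ext => [||u v]; [by lin..|].
  move: y; apply: tens_ext => [||u' v']; [by lin..|].
  by rewrite !F qs ns.
move=> x y z; move: x; apply: tens_ext => [||u v]; [by lin..|].
move: y; apply: tens_ext => [||u' v']; [by lin..|].
move: z; apply: tens_ext => [||u'' v'']; [by lin..|].
by rewrite !E !F [m v v']mc ni -(bilDl muP) qi (bil0l muP).
Qed.

(** Induction on the number n of pure tensors in t.  Let u be the left factor of
    one of them.  If every [phi i] kills u, that pure tensor is zero.  Otherwise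
    take [phi i u != 0]: applying [phi i] to the left factors gives a vanishing
    linear combination of the right factors, in which the one attached to u can
    be solved for; substituting it removes a pure tensor. *)
Lemma tens_separated (U V : lmodType K) (I J : Type)
    (phi : I -> U -> K^o) (psi : J -> V -> K^o) :
  (forall i, linear (phi i)) -> (forall j, linear (psi j)) ->
  (forall u, (forall i, phi i u = 0) -> u = 0) ->
  (forall v, (forall j, psi j v = 0) -> v = 0) ->
  forall t : tens U V,
    (forall i j, tlift (fun u v => phi i u * psi j v : K^o) t = 0) -> t = 0.
Proof.
move=> phil psil phi0 psi0.
have pP := tpure_bilinear U V.
have bP i j : bil (fun u v => phi i u * psi j v : K^o).
  split=> [v|u] a x y /=; first by rewrite (phil i) mulrDl -scalerAl.
  by rewrite (psil j) mulrDr -scalerAr.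
have main n : forall s : seq (U * V), size s = n ->
    let t := \sum_(p <- s) p.1 \ox p.2 in
    (forall i j, tlift (fun u v => phi i u * psi j v : K^o) t = 0) -> t = 0.
  elim: n => [|n IH] s; first by move/size0nil->; rewrite big_nil.
  case: s => // -[u v] s [ss] t t0.
  have [u0|] := pselect (forall i, phi i u = 0).
    have tE : t = \sum_(p <- s) p.1 \ox p.2.
      by rewrite /t big_cons (phi0 u u0) (bil0l pP) add0r.
    by rewrite tE; apply: IH => // i j; rewrite -tE.
  move=> /existsNP[i /eqP ui].
  (* Solve for v in the relation obtained by applying phi i on the left. *)
  have vE : v = \sum_(p <- s) (- (phi i u)^-1 * phi i p.1) *: p.2.
    apply/eqP; rewrite -subr_eq0; apply/eqP/psi0 => j.
    apply: (mulfI ui); rewrite mulr0 -(t0 i j) /t big_cons.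
    rewrite (linearPD (tlift_linear (bP i j))) (tlift_pure (bP i j)).
    rewrite (linearPB _ _ (psil j)) mulrBr; congr (_ + _).
    rewrite (linearP_sum _ _ (tlift_linear (bP i j))) (linearP_sum _ _ (psil j)).
    rewrite mulr_sumr -sumrN; apply: eq_bigr => p _.
    rewrite (tlift_pure (bP i j)) (linearPZ (psil j)) /GRing.scale /=.
    by rewrite !mulrA mulrN mulfV // !mulNr mul1r opprK.
  pose s' := [seq (p.1 + (- (phi i u)^-1 * phi i p.1) *: u, p.2) | p <- s].
  have tE : t = \sum_(p <- s') p.1 \ox p.2.
    rewrite big_map /= /t big_cons /= {1}vE (linearP_sum _ _ (pP.2 u)).
    rewrite addrC -big_split /=; apply: eq_bigr => p _.
    by rewrite (bilDl pP) (bilZl pP) (bilZr pP).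
  rewrite tE; apply: IH; first by rewrite size_map.
  by move=> i' j'; rewrite -tE.
by move=> t t0; rewrite [t]tens_sumE; apply: main => //; rewrite -tens_sumE.
Qed.

End TensorStructures.

(** * Laurent series *)

Section LaurentProduct.
Variable K : fieldType.
Implicit Types u v w : laurent K.

Definition vanishes_below (N : int) u := forall k, (k < N)%R -> lcoef u k = 0.

Definition truncation (N : int) (n : nat) u : {poly K} :=
  \poly_(i < n) lcoef u (N + i%:Z).

Lemma lmul_vanishes M N u v :
  vanishes_below M u -> vanishes_below N v -> vanishes_below (M + N) (lmul u v).
Proof.
move=> uM vN k kMN; rewrite /lcoef /= /lmul_coef fsbig1 // => i _.
have [/uM ->|Mi] := ltP i M; first by rewrite mul0r.
by rewrite vN ?mulr0 // ltrBlDl (lt_le_trans kMN) // lerD2r.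
Qed.

(** Above its lowest possible degree M + N, a product of Laurent series is
    computed by multiplying truncations, which are polynomials. *)
Lemma lcoef_lmul M N n m u v :
  vanishes_below M u -> vanishes_below N v -> (n < m)%N ->
  lcoef (lmul u v) (M + N + n%:Z) = (truncation M m u * truncation N m v)`_n.
Proof.
move=> uM vN nm; rewrite coefM /lcoef /= /lmul_coef.
pose X := [fset (M + i%:Z)%R | i in iota 0 n.+1]%fset.
rewrite (fsbigTE X); last first.
  move=> i iX.
  have [/uM ->|Mi] := ltP i M; first by rewrite mul0r.
  rewrite vN ?mulr0 // ltNge; apply/negP => h; move/negP: iX; apply.
  apply/imfsetP; rewrite /=; exists `|i - M|%N => /=.
    rewrite -[_ :: _]/(iota 0 n.+1) mem_iota /= add0n ltnS -lez_nat gez0_abs ?subr_ge0 //.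
    by move: h; rewrite lerBrDl [i + N]addrC [M + N]addrC -addrA lerD2l lerBlDl.
  by rewrite gez0_abs ?subr_ge0 // subrKC.
rewrite big_imfset => [|i j _ _ /addrI[]//].
rewrite [X in bigop.body _ X]undup_id ?iota_uniq // -[iota _ _]/(index_iota 0 n.+1).
rewrite big_mkord; apply: eq_bigr => i _.
have ilt : (i <= n)%N by rewrite -ltnS.
rewrite !coef_poly (leq_ltn_trans ilt nm) (leq_ltn_trans (leq_subr i n) nm).
congr (_ * lcoef v _); rewrite -subzn //.
by rewrite opprD addrACA [M + N]addrC addrK addrA.
Qed.

End LaurentProduct.

Section LaurentRing.
Variable K : fieldType.
Implicit Types u v w : laurent K.

Lemma laurent_vanishes u : exists N, vanishes_below N u.
Proof. exact: lcoef_bound. Qed.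

Lemma laurent_eq_from N u v : vanishes_below N u -> vanishes_below N v ->
  (forall n : nat, lcoef u (N + n%:Z) = lcoef v (N + n%:Z)) -> u = v.
Proof.
move=> uN vN uv; apply: laurent_ext => k.
have [kN|Nk] := ltP k N; first by rewrite uN ?vN.
have := uv `|k - N|%N.
by rewrite gez0_abs ?subr_ge0 // subrKC.
Qed.

Lemma lmulC : commutative (@lmul K).
Proof.
move=> u v; have [M uM] := laurent_vanishes u; have [N vN] := laurent_vanishes v.
apply: (@laurent_eq_from (M + N)); first exact: lmul_vanishes.
  by rewrite addrC; exact: lmul_vanishes.
move=> n; rewrite (lcoef_lmul uM vN (ltnSn n)) mulrC [M + N]addrC.
by rewrite (lcoef_lmul vN uM (ltnSn n)).
Qed.

Lemma truncation_lmul M N n m u v i :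
  vanishes_below M u -> vanishes_below N v -> (i < n)%N -> (n <= m)%N ->
  (truncation (M + N) n (lmul u v))`_i = (truncation M m u * truncation N m v)`_i.
Proof.
by move=> uM vN ni nm; rewrite coef_poly ni (lcoef_lmul uM vN (leq_trans ni nm)).
Qed.

(** Inherited from the associativity of polynomials, as a coefficient of a
    polynomial product sees only truncations of the factors. *)
Lemma lmulA : associative (@lmul K).
Proof.
move=> u v w; have [M uM] := laurent_vanishes u; have [N vN] := laurent_vanishes v.
have [L wL] := laurent_vanishes w.
have uvV := lmul_vanishes uM vN; have vwV := lmul_vanishes vN wL.
apply: (@laurent_eq_from (M + (N + L))); first exact: lmul_vanishes.
  by rewrite addrA; exact: lmul_vanishes.
move=> n; have nn := ltnSn n.
rewrite (lcoef_lmul uM vwV nn) addrA (lcoef_lmul uvV wL nn).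
transitivity ((truncation M n.+1 u * truncation N n.+1 v * truncation L n.+1 w)`_n).
  rewrite -mulrA coefM [RHS]coefM; apply: eq_bigr => i _.
  by rewrite (truncation_lmul vN wL _ (leqnn _)) // ltnS leq_subr.
rewrite coefM [RHS]coefM; apply: eq_bigr => i _.
by rewrite (truncation_lmul uM vN _ (leqnn _)).
Qed.

Lemma lmul_comm_product : comm_product (@lmul K).
Proof. by split; [exact: lmul_bilinear|exact: lmulC|exact: lmulA]. Qed.

Lemma Bmul_comm_product : comm_product (@Bmul K).
Proof. exact: comm_product_tens lmul_comm_product lmul_comm_product. Qed.

Lemma poly_comm_product : comm_product ( *%R : {poly K} -> _).
Proof. by split; [exact: poly_mul_bilinear|exact: mulrC|exact: mulrA]. Qed.

Lemma lcoef_linear k : linear (fun u => lcoef u k : K^o).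
Proof. by []. Qed.

Definition monomial_coef (n : int) : int -> K^o := fun k => (k == n)%:R.
Lemma monomial_set n : laurent_subspace K (monomial_coef n).
Proof. by exists n => k kn; rewrite /monomial_coef lt_eqF. Qed.
Definition monomial n : laurent K := in_carrier (monomial_set n).

(** Residues against monomials recover all coefficients. *)
Lemma res_lmul_monomial u n : res (lmul u (monomial n)) = lcoef u (-1 - n).
Proof.
rewrite /res {1}/lcoef /= /lmul_coef (fsbigTE [fset (-1 - n)]%fset).
  rewrite big_seq_fset1 /lcoef /= /monomial_coef.
  by rewrite opprB subrKC eqxx mulr1.
move=> i; rewrite inE => ine; rewrite [lcoef (monomial n) _]/lcoef /= /monomial_coef.
case: eqP => [h|]; last by rewrite mulr0.
by move: ine; rewrite -h opprB subrKC eqxx.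
Qed.

Definition power_coef u : int -> K^o := fun k => if 0 <= k then lcoef u k else 0.
Lemma power_coef_set u : laurent_subspace K (power_coef u).
Proof.
by have [N uN] := lcoef_bound u; exists N => k kN; rewrite /power_coef uN // if_same.
Qed.
Definition regular u : laurent K := in_carrier (power_coef_set u).
Definition principal u : laurent K := u - regular u.

Lemma lcoef_regular u k : lcoef (regular u) k = if 0 <= k then lcoef u k else 0.
Proof. by []. Qed.
Lemma lcoef_principal u k : lcoef (principal u) k = if 0 <= k then 0 else lcoef u k.
Proof.
rewrite /principal -[u - _]addrC -scaleN1r lcoefL lcoef_regular.
by case: ifP; rewrite mulN1r ?addNr // oppr0 add0r.
Qed.

Lemma regular_linear : linear regular.
Proof.
move=> a u v; apply: laurent_ext => k; rewrite lcoefL !lcoef_regular.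
by case: ifP; rewrite ?mulr0 ?addr0.
Qed.
Lemma principal_linear : linear principal.
Proof. by have rl := regular_linear; apply: lin_add; lin. Qed.
Lemma regular_power u : power_series K (regular u).
Proof. by move=> k k0; rewrite lcoef_regular leNgt k0. Qed.
Lemma principal_polar u : polar_part K (principal u).
Proof. by move=> k k0; rewrite lcoef_principal k0. Qed.
Lemma regular_id u : power_series K u -> regular u = u.
Proof.
move=> u0; apply: laurent_ext => k; rewrite lcoef_regular.
by case: (leP 0 k) => // /u0.
Qed.
Lemma principal_power u : power_series K u -> principal u = 0.
Proof. by move=> /regular_id ru; rewrite /principal ru subrr. Qed.
Lemma regular_polar u : polar_part K u -> regular u = 0.
Proof.
move=> u0; apply: laurent_ext => k; rewrite lcoef_regular.
by case: (leP 0 k) => // /u0.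
Qed.
Lemma principal_id u : polar_part K u -> principal u = u.
Proof. by move=> /regular_polar ru; rewrite /principal ru subr0. Qed.

Lemma res_power u v : power_series K u -> power_series K v -> res (lmul u v) = 0.
Proof. by move=> u0 v0; apply: (power_series_closed u0 v0). Qed.
Lemma res_polar u v : polar_part K u -> polar_part K v -> res (lmul u v) = 0.
Proof.
move=> u0 v0; rewrite /res /lcoef /= /lmul_coef fsbig1 // => i _.
have [/u0 ->|i0] := leP 0 i; first by rewrite mul0r.
by rewrite v0 ?mulr0 // subr_ge0 -ltzD1 addNr.
Qed.
End LaurentRing.

(** * Polynomials in s with coefficients in a vector space *)

Section Primitive.
Variable K : fieldType.
Hypothesis char0 : forall n, n.+1%:R != 0 :> K.
Implicit Types p q : {poly K}.

(** The primitive vanishing at 0: for i = 0 the quotient is a division by zero,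
    whose value is 0. *)
Definition primitive p : {poly K} := \poly_(i < (size p).+1) (p`_i.-1 / i%:R).

Lemma coef_primitive p i : (primitive p)`_i = p`_i.-1 / i%:R.
Proof.
rewrite coef_poly ltnS; case: leqP => // pi.
by case: i pi => // i pi; rewrite nth_default ?mul0r.
Qed.
Lemma primitive_linear : linear primitive.
Proof.
move=> a p q; apply/polyP => i.
by rewrite coefD coefZ !coef_primitive coefD coefZ mulrDl mulrA.
Qed.
Lemma deriv_primitive p : (primitive p)^`() = p.
Proof.
apply/polyP => i; rewrite coef_deriv coef_primitive /= -[_ *+ _]mulr_natr.
by rewrite divfK.
Qed.
Lemma primitive_deriv p : primitive p^`() = p - p.[0]%:P.
Proof.
apply/polyP => i; rewrite coef_primitive coefB coefC coef_deriv horner_coef0.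
case: i => [|i] /=; first by rewrite invr0 mulr0 subrr.
by rewrite -[_ *+ _]mulr_natr mulfK // subr0.
Qed.
Lemma primitive_at0 p : (primitive p).[0] = 0.
Proof. by rewrite horner_coef0 coef_primitive invr0 mulr0. Qed.
Lemma int01E p : int01 p = (primitive p).[1].
Proof.
rewrite (@horner_coef_wide _ (size p).+1) ?size_poly // big_ord_recl.
rewrite coef_primitive invr0 mulr0 mul0r add0r; apply: eq_bigr => i _.
by rewrite coef_primitive expr1n mulr1.
Qed.
End Primitive.

Section TensorCalculus.
Variable K : fieldType.
Hypothesis char0 : forall n, n.+1%:R != 0 :> K.

Lemma deriv_linear : linear (@deriv K).
Proof. by move=> a p q; rewrite derivD derivZ. Qed.

Section OneSpace.
Variable V : lmodType K.
Implicit Types (x : tens V {poly K}) (v : V).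

Definition tev (c : K) : tens V {poly K} -> V := tlift (fun v (p : {poly K}) => p.[c] *: v).
Definition tderiv : tens V {poly K} -> tens V {poly K} := tmap id (@deriv K).
Definition tprim : tens V {poly K} -> tens V {poly K} := tmap id (@primitive K).
Definition tconst v : tens V {poly K} := v \ox (1 : {poly K}).
(** The integral over s in [0, 1]. *)
Definition tint x : V := tev 1 (tprim x).

Lemma tev_bil c : bil (fun v (p : {poly K}) => p.[c] *: v).
Proof.
split=> [p|x] a y z /=; first by rewrite scalerDr !scalerA mulrC.
by rewrite hornerD hornerZ scalerDl scalerA.
Qed.
Lemma tev_linear c : linear (tev c).
Proof. exact: tlift_linear (tev_bil c). Qed.
Lemma tev_pure c v p : tev c (v \ox p) = p.[c] *: v.
Proof. exact: (tlift_pure (tev_bil c)). Qed.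
Lemma tderiv_linear : linear tderiv.
Proof. exact: tmap_linear (@lin_id _ _) deriv_linear. Qed.
Lemma tderiv_pure v p : tderiv (v \ox p) = v \ox p^`().
Proof. exact: (tmap_pure (@lin_id _ _) deriv_linear). Qed.
Lemma tprim_linear : linear tprim.
Proof. exact: tmap_linear (@lin_id _ _) (@primitive_linear K). Qed.
Lemma tprim_pure v p : tprim (v \ox p) = v \ox primitive p.
Proof. exact: (tmap_pure (@lin_id _ _) (@primitive_linear K)). Qed.
Lemma tconst_linear : linear tconst.
Proof. exact: ((tpure_bilinear V {poly K}).1 1). Qed.
Lemma tint_linear : linear tint.
Proof. have l1 := tev_linear 1; have l2 := tprim_linear; exact: lin_comp l1 l2. Qed.

Lemma tev_const c v : tev c (tconst v) = v.
Proof. by rewrite tev_pure hornerC scale1r. Qed.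
Lemma tderiv_const v : tderiv (tconst v) = 0.
Proof. by rewrite tderiv_pure derivC (bil0r (tpure_bilinear _ _)). Qed.
Lemma tderiv_prim x : tderiv (tprim x) = x.
Proof.
have l1 := tderiv_linear; have l2 := tprim_linear.
move: x; apply: tens_ext => [||v p]; [by lin..|].
by rewrite tprim_pure tderiv_pure deriv_primitive.
Qed.
Lemma tprim_deriv x : tprim (tderiv x) = x - tconst (tev 0 x).
Proof.
have l1 := tderiv_linear; have l2 := tprim_linear; have l3 := tev_linear 0.
have l4 := tconst_linear; have pP := tpure_bilinear V {poly K}.
move: x; apply: tens_ext => [||v p]; [by lin..|].
rewrite tderiv_pure tprim_pure primitive_deriv // tev_pure (bilDr pP) (bilNr pP).
by rewrite -[_%:P]mulr1 -alg_polyC -scalerAl mul1r (bilZr pP) (linearPZ l4).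
Qed.
Lemma tev0_prim x : tev 0 (tprim x) = 0.
Proof.
have l1 := tev_linear 0; have l2 := tprim_linear.
move: x; apply: tens_ext => [||v p]; [by lin..|].
by rewrite tprim_pure tev_pure primitive_at0 scale0r.
Qed.
Lemma tint_deriv x : tint (tderiv x) = tev 1 x - tev 0 x.
Proof. by rewrite /tint tprim_deriv (linearPB _ _ (tev_linear 1)) tev_const. Qed.
Lemma tint_const v : tint (tconst v) = v.
Proof.
have -> : tconst v = tderiv (v \ox 'X) by rewrite tderiv_pure derivX.
by rewrite tint_deriv !tev_pure !hornerX scale1r scale0r subr0.
Qed.

(** The primitive vanishing at s = 1, the point where the two components of an
    element of [g_Dx] are glued. *)
Definition tprim_from1 x := tprim x - tconst (tint x).
Lemma tprim_from1_linear : linear tprim_from1.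
Proof.
have l1 := tprim_linear; have l2 := tint_linear; have l3 := tconst_linear.
by apply: lin_add; lin.
Qed.
Lemma tev1_prim_from1 x : tev 1 (tprim_from1 x) = 0.
Proof. by rewrite (linearPB _ _ (tev_linear 1)) tev_const subrr. Qed.
Lemma tev0_prim_from1 x : tev 0 (tprim_from1 x) = - tint x.
Proof. by rewrite (linearPB _ _ (tev_linear 0)) tev_const tev0_prim sub0r. Qed.
Lemma tderiv_prim_from1 x : tderiv (tprim_from1 x) = x.
Proof. by rewrite (linearPB _ _ tderiv_linear) tderiv_const tderiv_prim subr0. Qed.
Lemma tprim_from1_deriv x : tprim_from1 (tderiv x) = x - tconst (tev 1 x).
Proof.
rewrite /tprim_from1 tprim_deriv tint_deriv (linearPB _ _ tconst_linear).
by rewrite opprB addrA subrK.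
Qed.
End OneSpace.

Section CoefMap.
Variables (V W : lmodType K) (f : V -> W).
Hypothesis fl : linear f.
Implicit Types (x : tens V {poly K}).
Let idl : linear (@id {poly K}) := @lin_id K {poly K}.
Definition coefwise : tens V {poly K} -> tens W {poly K} := tmap f id.

Lemma coefwise_linear : linear coefwise. Proof. exact: tmap_linear. Qed.
Lemma coefwise_pure v p : coefwise (v \ox p) = f v \ox p.
Proof. exact: (tmap_pure fl idl). Qed.
Lemma tev_coefwise c x : tev c (coefwise x) = f (tev c x).
Proof.
have l1 := @tev_linear V c; have l2 := @tev_linear W c; have l3 := coefwise_linear.
move: x; apply: tens_ext => [||v p]; [by lin..|].
by rewrite coefwise_pure !tev_pure (linearPZ fl).
Qed.
Lemma tderiv_coefwise x : tderiv (coefwise x) = coefwise (tderiv x).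
Proof.
have l1 := @tderiv_linear V; have l2 := @tderiv_linear W; have l3 := coefwise_linear.
move: x; apply: tens_ext => [||v p]; [by lin..|].
by rewrite tderiv_pure !coefwise_pure tderiv_pure.
Qed.
Lemma tprim_coefwise x : tprim (coefwise x) = coefwise (tprim x).
Proof.
have l1 := @tprim_linear V; have l2 := @tprim_linear W; have l3 := coefwise_linear.
move: x; apply: tens_ext => [||v p]; [by lin..|].
by rewrite tprim_pure !coefwise_pure tprim_pure.
Qed.
Lemma tint_coefwise x : tint (coefwise x) = f (tint x).
Proof. by rewrite /tint tprim_coefwise tev_coefwise. Qed.
End CoefMap.

Section Product.
Variables (U V W : lmodType K) (b : U -> V -> W).
Hypothesis bP : bil b.
Implicit Types (x : tens U {poly K}) (y : tens V {poly K}).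
Let mP : bil ( *%R : {poly K} -> _) := @poly_mul_bilinear K.
Definition poly_ext := tmap2 b ( *%R : {poly K} -> _).

Lemma poly_ext_bilinear : bil poly_ext. Proof. exact: tmap2_bilinear. Qed.
Lemma poly_ext_pure u p v q : poly_ext (u \ox p) (v \ox q) = b u v \ox (p * q).
Proof. exact: tmap2_pure. Qed.
Lemma tev_poly_ext c x y : tev c (poly_ext x y) = b (tev c x) (tev c y).
Proof.
have l1 := @tev_linear U c; have l2 := @tev_linear V c; have l3 := @tev_linear W c.
have eP := poly_ext_bilinear.
move: x; apply: tens_ext => [||u p]; [by lin..|].
move: y; apply: tens_ext => [||v q]; [by lin..|].
by rewrite poly_ext_pure !tev_pure hornerM (bilZl bP) (bilZr bP) scalerA.
Qed.
Lemma tderiv_poly_ext x y :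
  tderiv (poly_ext x y) = poly_ext (tderiv x) y + poly_ext x (tderiv y).
Proof.
have l1 := @tderiv_linear U; have l2 := @tderiv_linear V; have l3 := @tderiv_linear W.
have eP := poly_ext_bilinear.
move: x; apply: tens_ext => [||u p]; [by lin..|].
move: y; apply: tens_ext => [||v q]; [by lin..|].
rewrite poly_ext_pure !tderiv_pure !poly_ext_pure derivM.
by rewrite (bilDr (tpure_bilinear _ _)).
Qed.
Lemma poly_ext_constr x v : poly_ext x (tconst v) = coefwise (b^~ v) x.
Proof.
have eP := poly_ext_bilinear; have fl := bP.1 v; have l := coefwise_linear fl.
move: x; apply: tens_ext => [||u p]; [by lin..|].
by rewrite poly_ext_pure coefwise_pure // mulr1.
Qed.
End Product.
End TensorCalculus.

(** * The four components of g (x) K((w)) (x) K((z)) *)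

Section Components.
Variables (K : fieldType) (g : lie_algebra K).
Implicit Types (X Y : laurent K -> laurent K) (x y : gB g).
Let idl : linear (@id g) := @lin_id K g.

Definition component X Y : gB g -> gB g := tmap id (tmap X Y).

Section OneComponent.
Variables X Y : laurent K -> laurent K.
Hypotheses (Xl : linear X) (Yl : linear Y).
Lemma component_linear : linear (component X Y).
Proof. exact: tmap_linear idl (tmap_linear Xl Yl). Qed.
Lemma component_pure a u v : component X Y (a \ox (u \ox v)) = a \ox (X u \ox Y v).
Proof. by rewrite /component (tmap_pure idl (tmap_linear Xl Yl)) (tmap_pure Xl Yl). Qed.
End OneComponent.

Lemma gB_ext (W : lmodType K) (f h : gB g -> W) : linear f -> linear h ->
  (forall a u v, f (a \ox (u \ox v)) = h (a \ox (u \ox v))) -> forall x, f x = h x.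
Proof.
move=> fl hl fh; apply: tens_ext => // a; have pP := tpure_bilinear g (ringB K).
apply: tens_ext => //; by lin.
Qed.

(** The elements of a submodule g (x) A (x) B are spanned by pure tensors with
    factors in A and B. *)
Lemma gB_sub_ind (A B : subspace (laurent K)) (W : lmodType K) (f h : gB g -> W) :
  linear f -> linear h ->
  (forall a u v, A u -> B v -> f (a \ox (u \ox v)) = h (a \ox (u \ox v))) ->
  forall x, tens_sub (full_subspace g) (tens_sub A B) x -> f x = h x.
Proof.
move=> fl hl fh; have pP := tpure_bilinear g (ringB K).
apply: tens_sub_ind => [a b _||s t IHs IHt].
- move: b; apply: tens_sub_ind => [u v uA vB||s t IHs IHt]; first exact: fh.
    by rewrite (bil0r pP) (linearP0 fl) (linearP0 hl).
  by rewrite (bilDr pP) (linearPD fl) (linearPD hl) IHs IHt.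
- by rewrite (linearP0 fl) (linearP0 hl).
- by rewrite (linearPD fl) (linearPD hl) IHs IHt.
Qed.

Lemma component_in (A B : subspace (laurent K)) X Y : linear X -> linear Y ->
  (forall u, A (X u)) -> (forall v, B (Y v)) ->
  forall x, tens_sub (full_subspace g) (tens_sub A B) (component X Y x).
Proof.
move=> Xl Yl XA YB; have pP := tpure_bilinear g (ringB K).
have cl := component_linear Xl Yl.
apply: tens_ind => [a||s t IHs IHt].
- apply: tens_ind => [u v||s t IHs IHt].
  + rewrite component_pure //; apply: tens_sub_pure => //; exact: tens_sub_pure.
  + by rewrite (bil0r pP) (linearP0 cl); exact: subspace0.
  + by rewrite (bilDr pP) (linearPD cl); exact: subspaceD.
- by rewrite (linearP0 cl); exact: subspace0.
- by rewrite (linearPD cl); exact: subspaceD.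
Qed.

Lemma component_id (A B : subspace (laurent K)) X Y : linear X -> linear Y ->
  (forall u, A u -> X u = u) -> (forall v, B v -> Y v = v) ->
  forall x, tens_sub (full_subspace g) (tens_sub A B) x -> component X Y x = x.
Proof.
move=> Xl Yl XA YB; have cl := component_linear Xl Yl; have il := @lin_id K (gB g).
apply: gB_sub_ind => // a u v uA vB.
by rewrite component_pure // XA // YB.
Qed.

Lemma component_0l (A B : subspace (laurent K)) X Y : linear X -> linear Y ->
  (forall u, A u -> X u = 0) ->
  forall x, tens_sub (full_subspace g) (tens_sub A B) x -> component X Y x = 0.
Proof.
move=> Xl Yl XA; have cl := component_linear Xl Yl.
apply: gB_sub_ind => // [|a u v uA vB]; first exact: lin_0.
by rewrite component_pure // XA // (bil0l (tpure_bilinear _ _)) (bil0r (tpure_bilinear _ _)).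
Qed.

Lemma component_0r (A B : subspace (laurent K)) X Y : linear X -> linear Y ->
  (forall v, B v -> Y v = 0) ->
  forall x, tens_sub (full_subspace g) (tens_sub A B) x -> component X Y x = 0.
Proof.
move=> Xl Yl YB; have cl := component_linear Xl Yl.
apply: gB_sub_ind => // [|a u v uA vB]; first exact: lin_0.
by rewrite component_pure // YB // !(bil0r (tpure_bilinear _ _)).
Qed.

Let rl := @regular_linear K.
Let pl := @principal_linear K.
Definition pow_pow := component (@regular K) (@regular K).
Definition pow_pol := component (@regular K) (@principal K).
Definition pol_pow := component (@principal K) (@regular K).
Definition pol_pol := component (@principal K) (@principal K).

Lemma pow_pow_linear : linear pow_pow. Proof. exact: component_linear. Qed.
Lemma pow_pol_linear : linear pow_pol. Proof. exact: component_linear. Qed.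
Lemma pol_pow_linear : linear pol_pow. Proof. exact: component_linear. Qed.
Lemma pol_pol_linear : linear pol_pol. Proof. exact: component_linear. Qed.

Lemma component_sum x : x = pow_pow x + pow_pol x + (pol_pow x + pol_pol x).
Proof.
have l1 := pow_pow_linear; have l2 := pow_pol_linear; have l3 := pol_pow_linear; have l4 := pol_pol_linear.
have pP := tpure_bilinear g (ringB K); have qP := tpure_bilinear (laurent K) (laurent K).
move: x; apply: gB_ext => [||a u v]; [by lin..|].
rewrite /pow_pow /pow_pol /pol_pow /pol_pol !component_pure // -!(bilDr pP) -!(bilDr qP) -(bilDl qP).
by rewrite /principal !subrKC.
Qed.

Lemma pow_pow_in x : gB_wz g (pow_pow x).
Proof. by apply: component_in => //; exact: regular_power. Qed.
Lemma pol_pol_in x : gB_polar g (pol_pol x).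
Proof. by apply: component_in => //; exact: principal_polar. Qed.
Lemma gB_wz_w x : gB_wz g x -> gB_w g x.
Proof. by apply: tens_subS => // b; apply: tens_subS. Qed.
Lemma gB_wz_z x : gB_wz g x -> gB_z g x.
Proof. by apply: tens_subS => // b; apply: tens_subS. Qed.
Lemma pow_pol_in x : gB_w g (pow_pol x).
Proof. by apply: component_in => //; exact: regular_power. Qed.
Lemma pol_pow_in x : gB_z g (pol_pow x).
Proof. by apply: component_in => //; exact: regular_power. Qed.
Lemma pow_pow_id x : gB_wz g x -> pow_pow x = x.
Proof. by apply: component_id => //; exact: regular_id. Qed.
Lemma pol_pol_id x : gB_polar g x -> pol_pol x = x.
Proof. by apply: component_id => //; exact: principal_id. Qed.
Lemma pow_pow_polar x : gB_polar g x -> pow_pow x = 0.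
Proof. by apply: component_0l => //; exact: regular_polar. Qed.
Lemma pol_pow_w x : gB_w g x -> pol_pow x = 0.
Proof. by apply: component_0l => //; exact: principal_power. Qed.
Lemma pol_pol_w x : gB_w g x -> pol_pol x = 0.
Proof. by apply: component_0l => //; exact: principal_power. Qed.
Lemma pow_pol_z x : gB_z g x -> pow_pol x = 0.
Proof. by apply: component_0r => //; exact: principal_power. Qed.
Lemma pol_pol_z x : gB_z g x -> pol_pol x = 0.
Proof. by apply: component_0r => //; exact: principal_power. Qed.

End Components.

(** * The residue pairing *)

Section Form.
Variables (K : fieldType) (g : lie_algebra K) (kappa : g -> g -> K).
Hypothesis kP : invariant_form kappa.

Lemma lie_br_lie_bracket : lie_bracket (@lie_br K g).
Proof.
have bP := @lie_bilinear K g.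
have anti x y : lie_br x y = - lie_br (l := g) y x.
  apply/eqP; rewrite -addr_eq0; apply/eqP.
  have := lie_alternating (x + y); rewrite (bilDl bP) !(bilDr bP).
  by rewrite !lie_alternating add0r addr0.
split=> // x y z; have /eqP := lie_jacobi x y z.
rewrite -addrA addr_eq0 => /eqP ->.
by rewrite [lie_br z x]anti (bilNr bP) [lie_br z _]anti opprD !opprK addrC.
Qed.

Lemma gB_br_lie_bracket : lie_bracket (@gB_br K g).
Proof. exact: lie_bracket_tens lie_br_lie_bracket (@Bmul_comm_product K). Qed.

Lemma gBs_br_lie_bracket : lie_bracket (@gBs_br K g).
Proof. exact: lie_bracket_tens gB_br_lie_bracket (@poly_comm_product K). Qed.

Lemma kappa_inv_pairing : inv_pairing (@lie_br K g) (kappa : g -> g -> K^o).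
Proof. by have [h1 h2 h3 _] := kP; split. Qed.

Lemma scale_bil (V : lmodType K) : bil (fun (c : K^o) (v : V) => c *: v).
Proof.
split=> [v|c] a x y /=; first by rewrite scalerDl scalerA.
by rewrite scalerDr !scalerA mulrC.
Qed.

Lemma kappa_B_inv_pairing : inv_pairing (@gB_br K g) (kappa_B kappa).
Proof.
have [BP BC BA] := @Bmul_comm_product K.
by apply: (inv_pairing_tens (@lie_bilinear K g) kappa_inv_pairing
  (@Bmul_comm_product K) BP (scale_bil _)).
Qed.

Lemma kappa_B_pure a b a' b' : kappa_B kappa (a \ox b) (a' \ox b') = kappa a a' *: Bmul b b'.
Proof.
exact: (tprod_pure (scale_bil _) (ip_bil kappa_inv_pairing) (cp_bil (@Bmul_comm_product K))).
Qed.

Lemma kappa_Bs_inv_pairing : inv_pairing (@gBs_br K g) (kappa_Bs kappa).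
Proof.
have pP := cp_bil (@poly_comm_product K).
apply: (inv_pairing_tens (@gB_br_bilinear K g) kappa_B_inv_pairing
  (@poly_comm_product K) pP (tpure_bilinear _ _)) => x y *; rewrite ?mulrA //.
exact: mulrC.
Qed.

Lemma resL (a : K) (u v : laurent K) : res (a *: u + v) = a * res u + res v.
Proof. exact: lcoefL. Qed.
Lemma res_wz_bil : bil (fun u v : laurent K => (res u * res v : K^o)).
Proof.
split=> [v|u] a x y; cbv beta; rewrite resL; first by rewrite mulrDl -mulrA.
by rewrite mulrDr mulrCA.
Qed.
Lemma res_wz_linear : linear (@res_wz K : ringB K -> K^o).
Proof. exact: tlift_linear res_wz_bil. Qed.
Lemma res_wz_pure (u v : laurent K) : res_wz (u \ox v) = res u * res v.
Proof. exact: (tlift_pure res_wz_bil). Qed.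

Definition res_form (x y : gB g) : K^o := res_wz (kappa_B kappa x y).

Lemma res_form_bil : bil res_form.
Proof.
have rl := res_wz_linear; have [kl kr] := ip_bil kappa_B_inv_pairing.
split=> y; exact: lin_comp rl _.
Qed.

Lemma Bmul_pure (u v u' v' : laurent K) :
  Bmul (u \ox v) (u' \ox v') = lmul u u' \ox lmul v v'.
Proof. exact: (tmap2_pure (@lmul_bilinear K) (@lmul_bilinear K)). Qed.

Lemma res_form_pure a u v a' u' v' :
  res_form (a \ox (u \ox v)) (a' \ox (u' \ox v')) =
  kappa a a' * (res (lmul u u') * res (lmul v v')).
Proof.
by rewrite /res_form kappa_B_pure Bmul_pure (linearPZ res_wz_linear) res_wz_pure.
Qed.

(** This covers the regularity conditions in w and in z as well as polar
    coefficients: in each case one of the two residues vanishes. *)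
Lemma res_form_isotropic (A B : subspace (laurent K)) :
  (forall u u' v v', A u -> A u' -> B v -> B v' -> res (lmul u u') * res (lmul v v') = 0) ->
  forall x y, tens_sub (full_subspace g) (tens_sub A B) x ->
    tens_sub (full_subspace g) (tens_sub A B) y -> res_form x y = 0.
Proof.
move=> AB x y xS yS; have [rl rr] := res_form_bil.
move: x xS; apply: gB_sub_ind => [//||a u v uA vB]; first exact: lin_0.
move: y yS; apply: gB_sub_ind => [//||a' u' v' uA' vB']; first exact: lin_0.
by rewrite res_form_pure AB ?mulr0.
Qed.

Lemma res_form_w x y : gB_w g x -> gB_w g y -> res_form x y = 0.
Proof. by apply: res_form_isotropic => u u' v v' uA uA' _ _; rewrite res_power ?mul0r. Qed.
Lemma res_form_z x y : gB_z g x -> gB_z g y -> res_form x y = 0.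
Proof.
by apply: res_form_isotropic => u u' v v' _ _ vB vB'; rewrite [res (lmul v v')]res_power ?mulr0.
Qed.
Lemma res_form_polar x y : gB_polar g x -> gB_polar g y -> res_form x y = 0.
Proof. by apply: res_form_isotropic => u u' v v' uA uA' _ _; rewrite res_polar ?mul0r. Qed.

Definition Bcoef (m n : int) : ringB K -> K^o :=
  tlift (fun u v : laurent K => (lcoef u m * lcoef v n : K^o)).
Definition gBcoef (c : g * (int * int)) : gB g -> K^o :=
  tlift (fun a b => (kappa a c.1 * Bcoef c.2.1 c.2.2 b : K^o)).

Lemma Bcoef_bil m n : bil (fun u v : laurent K => (lcoef u m * lcoef v n : K^o)).
Proof.
split=> [v|u] a x y; cbv beta; rewrite lcoefL; first by rewrite mulrDl -mulrA.
by rewrite mulrDr mulrCA.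
Qed.
Lemma Bcoef_linear m n : linear (Bcoef m n).
Proof. exact: tlift_linear (Bcoef_bil m n). Qed.
Lemma gBcoef_bil c : bil (fun (a : g) b => (kappa a c.1 * Bcoef c.2.1 c.2.2 b : K^o)).
Proof.
have [[kl _] _ _ _] := kP.
split=> [b|x] a y z /=; first by rewrite (kl c.1) mulrDl -mulrA.
by rewrite Bcoef_linear mulrDr mulrCA.
Qed.
Lemma gBcoef_linear c : linear (gBcoef c).
Proof. exact: tlift_linear (gBcoef_bil c). Qed.
Lemma gBcoef_pure c a u v :
  gBcoef c (a \ox (u \ox v)) = kappa a c.1 * (lcoef u c.2.1 * lcoef v c.2.2).
Proof. by rewrite /gBcoef (tlift_pure (gBcoef_bil c)) /Bcoef (tlift_pure (Bcoef_bil _ _)). Qed.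

Lemma Bcoef_separated b : (forall m n, Bcoef m n b = 0) -> b = 0.
Proof.
move=> b0.
have sep (u : laurent K) : (forall k, (lcoef u k : K^o) = 0) -> u = 0.
  by move=> u0; apply: laurent_ext => k; rewrite u0.
exact: (tens_separated (@lcoef_linear K) (@lcoef_linear K) sep sep b0).
Qed.

(** The non-degeneracy of [kappa] separates g, and the coefficients separate
    Laurent series; [tens_separated] puts them together. *)
Lemma gBcoef_separated x : (forall c, gBcoef c x = 0) -> x = 0.
Proof.
move=> x0; have [[kl _] _ _ knd] := kP.
apply: (tens_separated (phi := fun a u => (kappa u a : K^o))
   (psi := fun mn b => Bcoef mn.1 mn.2 b)) => //.
- by move=> mn; exact: Bcoef_linear.
- by move=> b b0; apply: Bcoef_separated => m n; exact: (b0 (m, n)).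
- by move=> a mn; exact: (x0 (a, mn)).
Qed.

Lemma res_form_monomial a m n x :
  res_form x (a \ox (monomial K m \ox monomial K n)) = gBcoef (a, (-1 - m, -1 - n)) x.
Proof.
have [rl _] := res_form_bil; have cl := gBcoef_linear (a, (-1 - m, -1 - n)).
move: x; apply: gB_ext => [//|//|a' u v].
by rewrite res_form_pure gBcoef_pure !res_lmul_monomial.
Qed.

Lemma gBcoef_pol_pol c x :
  gBcoef c (pol_pol x) = if (c.2.1 < 0) && (c.2.2 < 0) then gBcoef c x else 0.
Proof.
have cl := gBcoef_linear c; have pl := @pol_pol_linear K g.
case: ifP => h; move: x; apply: gB_ext => [||a u v]; try by lin.
  rewrite /pol_pol component_pure; try exact: principal_linear.
  rewrite !gBcoef_pure !lcoef_principal !leNgt.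
  by case/andP: h => -> ->.
rewrite /pol_pol component_pure; try exact: principal_linear.
rewrite !gBcoef_pure !lcoef_principal !leNgt.
by move: h; case: (_ < _) => //= [->|]; rewrite ?mul0r !mulr0.
Qed.

Lemma res_form_nondeg x : (forall y, res_form x y = 0) -> x = 0.
Proof.
move=> x0; apply: gBcoef_separated => -[a [m n]].
have := x0 (a \ox (monomial K (-1 - m) \ox monomial K (-1 - n))).
by rewrite res_form_monomial !opprB !subrKC.
Qed.

Lemma monomial_power n : 0 <= n -> power_series K (monomial K n).
Proof.
move=> n0 k k0; rewrite /lcoef /= /monomial_coef; case: eqP => // kn.
by move: k0; rewrite kn ltNge n0.
Qed.

(** Monomials with non-negative exponents detect exactly the coefficients with
    both exponents negative. *)
Lemma res_form_nondeg_pol_pol x : (forall y, gB_wz g y -> res_form x y = 0) -> pol_pol x = 0.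
Proof.
move=> x0; apply: gBcoef_separated => -[a [m n]]; rewrite gBcoef_pol_pol /=.
case: ifP => // /andP[m0 n0].
have mon k : k < 0 -> power_series K (monomial K (-1 - k)).
  by move=> k0; apply: monomial_power; rewrite subr_ge0 -ltzD1 addNr.
have := x0 (a \ox (monomial K (-1 - m) \ox monomial K (-1 - n))).
rewrite res_form_monomial !opprB !subrKC; apply.
by apply: tens_sub_pure => //; apply: tens_sub_pure; exact: mon.
Qed.

End Form.

(** * The dg Lie algebras *)

Section Restriction.
Variables (K : fieldType) (a : dgl_data K) (S : subspace a).
Hypotheses (S_part : forall n x, S x -> S (dg_part n x))
  (S_d : forall x, S x -> S (dg_d x)) (S_br : mul_closed (@dgl_br K a) S).
Let b := dgl_restrict S_part S_d S_br.

Lemma homog_cval n (x : b) : homog n x -> homog n (cval x : a).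
Proof. by rewrite /homog => h; rewrite -{2}h. Qed.

Lemma cval_sum (I : Type) (s : seq I) (F : I -> carrier S) :
  cval (\sum_(i <- s) F i) = \sum_(i <- s) cval (F i).
Proof. exact: (@linearP_sum K _ _ (@cval K a S)). Qed.

Lemma dgl_restrict_lie : is_dg_lie a -> is_dg_lie b.
Proof.
case=> [[pl pp ps [dl dd] d2] [bl br] bd ba bj bL]; split.
- split.
  + by move=> n c x y; apply: val_inj; exact: pl.
  + by move=> m n x; apply: val_inj; rewrite /= pp; case: eqP.
  + move=> x; have [s su xE] := ps (cval x); exists s => //.
    by apply: val_inj; rewrite /= cval_sum.
  + split=> [c x y|n x]; apply: val_inj; [exact: dl|exact: dd].
  + by move=> x; apply: val_inj; exact: d2.
- split=> [y|y] c x x'; apply: val_inj; [exact: bl|exact: br].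
- move=> i j x y /homog_cval hx /homog_cval hy; apply: val_inj; exact: (bd _ _ _ _ hx hy).
- move=> i j x y /homog_cval hx /homog_cval hy; apply: val_inj; exact: (ba _ _ _ _ hx hy).
- move=> i j k x y z /homog_cval hx /homog_cval hy /homog_cval hz; apply: val_inj.
  exact: (bj _ _ _ _ _ _ hx hy hz).
- move=> i x y /homog_cval hx; apply: val_inj; exact: (bL _ _ _ hx).
Qed.
End Restriction.

Section Forms.
Variables (K : fieldType) (g : lie_algebra K).
Implicit Types (f F h H : gBs g).

Lemma form_pairs_eq (x y : form_pairs g) : x.1.1 = y.1.1 -> x.1.2 = y.1.2 ->
  x.2.1 = y.2.1 -> x.2.2 = y.2.2 -> x = y.
Proof.
by case: x y => [[? ?] [? ?]] [[? ?] [? ?]] /= -> -> -> ->.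
Qed.

(** The zero element is homogeneous of every degree, hence the third case. *)
Variant homog_pairs_spec : int -> form_pairs g -> Prop :=
| HomogFunctions f h : homog_pairs_spec 0 ((f, 0), (h, 0))
| HomogOneForms F H : homog_pairs_spec 1 ((0, F), (0, H))
| HomogZero n : homog_pairs_spec n 0.

Lemma homog_pairsP n (x : form_pairs g) : homog n x -> homog_pairs_spec n x.
Proof.
case: x => [[f F] [h H]] [<- <- <- <-].
have [->|n0] := eqVneq n 0; first exact: HomogFunctions.
have [->|n1] := eqVneq n 1; first exact: HomogOneForms.
exact: HomogZero.
Qed.

Lemma ds_linear : linear (@ds K g). Proof. exact: tderiv_linear. Qed.
Lemma ds_br f h : ds (gBs_br f h) = gBs_br (ds f) h + gBs_br f (ds h).
Proof. exact: (tderiv_poly_ext (@gB_br_bilinear K g)). Qed.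

Lemma form_pairs_is_dg_space : is_dg_space (form_pairs g).
Proof.
split.
- move=> n a [[f F] [h H]] [[f' F'] [h' H']]; rewrite /= /form_part /=.
  by apply: form_pairs_eq; rewrite /=; case: eqP => _ //; rewrite scaler0 addr0.
- move=> m n [[f F] [h H]]; rewrite /= /form_part /=.
  have [->|mn] := eqVneq m n; first by case: eqP => _; case: eqP.
  by apply: form_pairs_eq; rewrite /=;
    (case: eqP => // m0; case: eqP => // n0; case/eqP: mn; rewrite m0 n0).
- move=> [[f F] [h H]]; exists [:: 0; 1] => //.
  rewrite !big_cons big_nil /= /form_part /= /GRing.add /=.
  by apply: form_pairs_eq; rewrite /= ?addr0 ?add0r.
- have dl := ds_linear; split.
    move=> a [[f F] [h H]] [[f' F'] [h' H']]; rewrite /= /form_d /=.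
    by apply: form_pairs_eq; rewrite /= ?dl ?scaler0 ?addr0.
  move=> n [[f F] [h H]]; rewrite /= /form_d /form_part /=.
  have -> : (n + 1 == 1) = (n == 0) by rewrite -subr_eq0 addrK.
  by apply: form_pairs_eq; rewrite /=; case: eqP => // _; rewrite (linearP0 dl).
- move=> [[f F] [h H]]; rewrite /= /form_d /=.
  by rewrite (linearP0 ds_linear).
Qed.

Lemma form_pairs_is_dg_lie : is_dg_lie (form_pairs g).
Proof.
have [bP ba bj] := gBs_br_lie_bracket g; have dl := ds_linear.
have d0 := linearP0 dl; have b0l := bil0l bP; have b0r := bil0r bP.
have E0 : forall x : form_pairs g, dgl_br 0 x = 0.
  by move=> x; rewrite /= /form_br /= !b0l !addr0.
have E0r : forall x : form_pairs g, dgl_br x 0 = 0.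
  by move=> x; rewrite /= /form_br /= !b0r !addr0.
split; first exact: form_pairs_is_dg_space.
- split=> [[[f F] [h H]]|[[f F] [h H]]] a [[f1 F1] [h1 H1]] [[f2 F2] [h2 H2]];
  apply: form_pairs_eq; rewrite /= ?(bilDl bP, bilDr bP) ?(bilZl bP, bilZr bP) //;
  by rewrite scalerDr addrACA.
- move=> i j x y /homog_pairsP[f h|F H|n] /homog_pairsP[f' h'|F' H'|n'];
  rewrite ?E0 ?E0r /homog; apply: form_pairs_eq; rewrite /= /form_part /=;
  by rewrite ?b0l ?b0r ?addr0 ?if_same.
- move=> i j x y /homog_pairsP[f h|F H|n] /homog_pairsP[f' h'|F' H'|n'];
  rewrite ?E0 ?E0r ?scaler0 ?oppr0 //;
  apply: form_pairs_eq; rewrite /= ?b0l ?b0r ?addr0 ?add0r /ksign /=;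
  rewrite ?expr0 ?scale1r ?scaler0 ?oppr0 //;
  exact: ba.
- move=> i j k x y z /homog_pairsP[f h|F H|n];
  move=> /homog_pairsP[f' h'|F' H'|n'] /homog_pairsP[f'' h''|F'' H''|n''];
  rewrite ?(E0, E0r) ?scaler0 ?addr0 ?E0 //;
  apply: form_pairs_eq; rewrite /= ?(b0l, b0r, addr0, add0r) /ksign /=;
  rewrite ?expr0 ?scale1r ?scaler0 ?(b0l, b0r, addr0, add0r) //;
  exact: bj.
- move=> i x y /homog_pairsP[f h|F H|n]; case: y => [[f' F'] [h' H']];
  rewrite ?(E0, E0r) ?scaler0 ?addr0;
  apply: form_pairs_eq; rewrite /= ?d0 ?(b0l, b0r, addr0, add0r) /ksign /=;
  rewrite ?expr0 ?scale1r ?scaler0 ?d0 ?addr0 //;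
  exact: ds_br.
Qed.
End Forms.

Section Degree0.
Variable K : fieldType.

(** In degree 0 the signs and the differential disappear. *)
Lemma degree0_dg_lie (V : lmodType K) (b : V -> V -> V) : lie_bracket b ->
  is_dg_lie (@DglData K (@DgData K V (fun n x => if n == 0 then x else 0) (fun=> 0)) b).
Proof.
case=> bP ba bj.
have H i (x : V) : (if i == 0 then x else 0) = x -> i = 0 \/ x = 0.
  by case: eqP; [left|right].
have d0 (x : V) : (0 : V) = 0 + x *+ 0 by rewrite addr0.
split=> //.
- split=> //=.
  + by move=> n a x y /=; case: eqP => // _; rewrite scaler0 addr0.
  + move=> m n x; have [->|mn] := eqVneq m n; first by case: eqP.
    by case: eqP => // m0; case: eqP => // n0; case/eqP: mn; rewrite m0 n0.
  + by move=> x; exists [:: 0] => //; rewrite big_seq1.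
  + by split=> [a x y|n x] /=; rewrite ?scaler0 ?addr0 //= if_same.
- move=> i j x y; rewrite /homog /= => /H[->|->] /H[->|->];
  by rewrite ?(bil0l bP, bil0r bP) ?if_same.
- move=> i j x y; rewrite /homog /= => /H[->|->] /H[->|->];
  rewrite ?(bil0l bP, bil0r bP) ?scaler0 ?oppr0 //.
  by rewrite /ksign expr0 scale1r; exact: ba.
- move=> i j k x y z; rewrite /homog /= => /H[->|->] /H[->|->] _;
  rewrite ?(bil0l bP, bil0r bP) ?scaler0 ?addr0 //.
  by rewrite /ksign expr0 scale1r; exact: bj.
- by move=> i x y _ /=; rewrite (bil0l bP) (bil0r bP) scaler0 addr0.
Qed.
End Degree0.

(** * The pairing of forms *)

Section Pairing.
Variables (K : fieldType) (g : lie_algebra K) (kappa : g -> g -> K).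
Hypothesis kP : invariant_form kappa.
Hypothesis char0 : forall n, n.+1%:R != 0 :> K.
Implicit Types (f h F H : gBs g) (x y : form_pairs g).

Definition int_res (t : tens (ringB K) {poly K}) : K^o := res_wz (tint t).
(** The integral over [0, 1] of the residue of kappa(f, h); all of the pairing is
    expressed through it. *)
Definition int_form f h : K^o := int_res (kappa_Bs kappa f h).

Lemma int_res_linear : linear int_res.
Proof.
have l1 := @res_wz_linear K; have l2 := @tint_linear K (ringB K); exact: lin_comp l1 l2.
Qed.

Lemma int01_linear : linear (@int01 K : {poly K} -> K^o).
Proof. by move=> a p q; rewrite !int01E (@primitive_linear K) hornerD hornerZ. Qed.

Lemma int01_res_wz t : int01 (res_wz_s t) = int_res t.
Proof.
have l1 := int01_linear; have l2 := int_res_linear.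
have bP : bil (fun (b : ringB K) (p : {poly K}) => res_wz b *: p).
  have sP := scale_bil {poly K}; have rl := @res_wz_linear K.
  by split=> [p|b]; [exact: (lin_l p sP rl)|exact: (sP.2 (res_wz b))].
have l3 : linear (@res_wz_s K) := tlift_linear bP.
move: t; apply: (@tens_ext K _ _ K^o (fun t => int01 (res_wz_s t)) int_res) => [||b p]; [by lin..|].
rewrite /res_wz_s (tlift_pure bP) (linearPZ l1) int01E /int_res /tint tprim_pure tev_pure.
by rewrite (linearPZ (@res_wz_linear K)) [LHS]mulrC.
Qed.

Lemma int_form_bil : bil int_form.
Proof.
have l := int_res_linear; have [kl kr] := ip_bil (kappa_Bs_inv_pairing kP).
by split=> y; [exact: (lin_comp l (kl y))|exact: (lin_comp l (kr y))].
Qed.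
Lemma int_form_sym f h : int_form f h = int_form h f.
Proof. by rewrite /int_form (ip_sym (kappa_Bs_inv_pairing kP)). Qed.
Lemma int_form_inv f h F :
  int_form (gBs_br f h) F + int_form h (gBs_br f F) = 0.
Proof.
have l := int_res_linear.
by rewrite /int_form -(linearPD l) (ip_inv (kappa_Bs_inv_pairing kP)) (linearP0 l).
Qed.
Lemma int_form_stokes f h :
  int_form (ds f) h + int_form f (ds h) =
  res_form kappa (tev 1 f) (tev 1 h) - res_form kappa (tev 0 f) (tev 0 h).
Proof.
have l := int_res_linear; have kb := ip_bil (kappa_B_inv_pairing kP).
rewrite /int_form -(linearPD l) -[_ + _](tderiv_poly_ext kb).
rewrite /int_res tint_deriv // (linearPB _ _ (@res_wz_linear K)).
by rewrite !(tev_poly_ext kb).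
Qed.
Lemma int_form_constr f b : int_form f (tconst b) = res_form kappa (tint f) b.
Proof.
have kb := ip_bil (kappa_B_inv_pairing kP).
by rewrite /int_form /int_res [kappa_Bs _ _ _](poly_ext_constr kb) tint_coefwise //; exact: (kb.1 b).
Qed.

Lemma int_form_polar f h : gBs_polar g f -> gBs_polar g h -> int_form f h = 0.
Proof.
have [bl br] := int_form_bil; have kb := ip_bil (kappa_B_inv_pairing kP).
have rl := @res_wz_linear K.
move=> fS hS; move: f fS; apply: tens_sub_ind => [u p uS _||s t IHs IHt].
- move: h hS; apply: tens_sub_ind => [v q vS _||s t IHs IHt].
  + rewrite /int_form /int_res [kappa_Bs _ _ _](poly_ext_pure kb).
    rewrite /tint tprim_pure tev_pure (linearPZ rl).
    by have := res_form_polar kP uS vS; rewrite /res_form => ->; rewrite scaler0.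
  + exact: linearP0 (br _).
  + by rewrite (linearPD (br _)) IHs IHt addr0.
- exact: linearP0 (bl _).
- by rewrite (linearPD (bl _)) IHs IHt addr0.
Qed.

Lemma pairing_formE x y : pairing_form kappa x y =
  2^-1 * (int_form x.1.1 y.1.2 + int_form x.1.2 y.1.1
          - (int_form x.2.1 y.2.2 + int_form x.2.2 y.2.1)).
Proof.
have l := int_res_linear.
by rewrite /pairing_form !int01_res_wz /kappa_wedge1 !(linearPD l).
Qed.

Lemma pairing_form_bil : bil (fun x y : form_pairs g => (pairing_form kappa x y : K^o)).
Proof.
have qP := int_form_bil.
split=> [y|x] a x1 x2; cbv beta; rewrite !pairing_formE /=.
  rewrite !(bilDl qP) !(bilZl qP).
  by rewrite /GRing.scale /= !mulrDr !opprD !mulrDr !mulrN; ring.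
by rewrite !(bilDr qP) !(bilZr qP) /GRing.scale /=; ring.
Qed.

Lemma pairing_form_sym x y : pairing_form kappa x y = pairing_form kappa y x.
Proof.
by rewrite !pairing_formE; congr (_ * (_ - _)); rewrite addrC; congr (_ + _); exact: int_form_sym.
Qed.

(** When x and y both have degree 1 a sign appears, but then both terms vanish,
    being pairings of forms of total degree at least 2. *)
Lemma pairing_form_inv i j x y z : homog i x -> homog j y ->
  pairing_form kappa (dgl_br x y) z + ksign K (i * j) * pairing_form kappa y (dgl_br x z) = 0.
Proof.
have qP := int_form_bil; have bP := @gBs_br_bilinear K g.
have I f h F : int_form h (gBs_br f F) = - int_form (gBs_br f h) F.
  by apply/eqP; rewrite -addr_eq0 addrC int_form_inv.
move=> /homog_pairsP[f h|F H|n] /homog_pairsP[f' h'|F' H'|n'];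
case: z => [[z1 z2] [z3 z4]];
rewrite !pairing_formE /= /ksign /= ?expr0 ?mul1r.
all: rewrite ?(bil0l bP, bil0r bP) ?(bil0l qP, bil0r qP) ?(addr0, add0r).
all: rewrite ?(bil0l qP, bil0r qP) ?subr0 ?mulr0 ?addr0 //.
all: rewrite ?(bil0l qP, bil0r qP) ?(bilDl qP, bilDr qP) ?I ?(bil0l bP, bil0r bP).
all: rewrite ?(bil0l qP, bil0r qP) ?oppr0 ?(addr0, add0r); try ring.
Qed.

(** Stokes' formula leaves the boundary terms at s = 1, which are equal for the
    two components, and those at s = 0, where both functions are regular in the
    same variable and their residue pairing vanishes. *)
Lemma pairing_form_inv_d x y : punctured_cond x -> punctured_cond y ->
  forall i, homog i x ->
  pairing_form kappa (dg_d x) y + ksign K i * pairing_form kappa x (dg_d y) = 0.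
Proof.
have qP := int_form_bil; have dl := @ds_linear K g; have d0 := linearP0 dl.
have [rl rr] := res_form_bil kP.
case=> [xg xw xz] [yg yw yz] i /homog_pairsP xi.
move: xg xw xz; case: xi => [f h|F H|n] /= xg xw xz;
case: y yg yw yz => [[y1 y2] [y3 y4]] /= yg yw yz;
rewrite !pairing_formE /= ?d0 ?(bil0l qP, bil0r qP) ?(addr0, add0r) ?oppr0 ?addr0 ?mulr0 ?addr0 //.
rewrite /ksign expr0 mul1r -mulrDr.
have -> : int_form (ds f) y1 - int_form (ds h) y3 + (int_form f (ds y1) - int_form h (ds y3)) =
  (int_form (ds f) y1 + int_form f (ds y1)) - (int_form (ds h) y3 + int_form h (ds y3)) by ring.
rewrite !int_form_stokes.
rewrite [res_form _ (tev 0 f) _](res_form_w kP xw yw).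
rewrite [res_form _ (tev 0 h) _](res_form_z kP xz yz).
by rewrite !subr0 -[tev 1 f]/(ev 1 f) -[tev 1 y1]/(ev 1 y1) xg yg subrr mulr0.
Qed.

End Pairing.

(** * The homotopy Manin triple *)

Section ManinTriple.
Variables (K : fieldType) (g : lie_algebra K) (kappa : g -> g -> K).
Hypothesis kP : invariant_form kappa.
Hypothesis char0 : forall n, n.+1%:R != 0 :> K.

Lemma g_Dx_dg_lie : is_dg_lie (g_Dx g).
Proof. exact/dgl_restrict_lie/form_pairs_is_dg_lie. Qed.
Lemma g_minus_dg_lie : is_dg_lie (g_minus g).
Proof. exact/dgl_restrict_lie/form_pairs_is_dg_lie. Qed.
Lemma g_plus_dg_lie : is_dg_lie (g_plus g).
Proof. exact/dgl_restrict_lie/degree0_dg_lie/gB_br_lie_bracket. Qed.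

Lemma punctured_intro (f F h H : gBs g) :
  tev 1 f = tev 1 h -> gB_w g (tev 0 f) -> gB_z g (tev 0 h) ->
  punctured_subspace g ((f, F), (h, H)).
Proof. by move=> h1 h2 h3; split. Qed.

Lemma punctured_elim (x : g_Dx g) :
  [/\ tev 1 (cval x).1.1 = tev 1 (cval x).2.1,
      gB_w g (tev 0 (cval x).1.1) & gB_z g (tev 0 (cval x).2.1)].
Proof. by have [] : punctured_cond (cval x) := cvalP x. Qed.

Lemma i_plus_linear : linear (@i_plus K g).
Proof.
have cl := @tconst_linear K (gB g).
move=> a x y; apply: val_inj; apply: form_pairs_eq; rewrite /= ?scaler0 ?addr0 //; exact: cl.
Qed.
Lemma i_minus_linear : linear (@i_minus K g).
Proof. by move=> a x y; apply: val_inj. Qed.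

Lemma i_plus_dg_lie_map : dg_lie_map (@i_plus K g).
Proof.
have cl := @tconst_linear K (gB g); have bP := @gBs_br_bilinear K g.
split; first split; first split; first exact: i_plus_linear.
- move=> n x; apply: val_inj; apply: form_pairs_eq; rewrite /= addr0; case: eqP => // _;
  by rewrite ?if_same //; exact: linearP0 cl.
- move=> x; apply: val_inj; apply: form_pairs_eq; rewrite /= ?[ds (const_s _)]tderiv_const //;
  exact: linearP0 cl.
- move=> x y; apply: val_inj; apply: form_pairs_eq; rewrite /= ?(bil0l bP, bil0r bP) ?addr0 //;
  by rewrite [RHS](poly_ext_pure (@gB_br_bilinear K g)) mulr1.
Qed.
Lemma i_minus_dg_lie_map : dg_lie_map (@i_minus K g).
Proof.
split; first split; first split; first exact: i_minus_linear.
- by move=> n x; apply: val_inj; rewrite /= addr0.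
- by move=> x; apply: val_inj.
- by move=> x y; apply: val_inj.
Qed.

Definition polar_coef : gBs g -> gBs g := coefwise (@pol_pol K g).

Lemma polar_coef_linear : linear polar_coef.
Proof. exact: coefwise_linear (@pol_pol_linear K g). Qed.

Lemma polar_coef_in f : gBs_polar g (polar_coef f).
Proof.
have l := polar_coef_linear; have pl := @pol_pol_linear K g.
move: f; apply: tens_ind => [v p||s t IHs IHt].
- by rewrite /polar_coef coefwise_pure //; apply: tens_sub_pure => //; exact: pol_pol_in.
- by rewrite (linearP0 l); exact: subspace0.
- by rewrite (linearPD l); exact: subspaceD.
Qed.

Lemma polar_coef_id f : gBs_polar g f -> polar_coef f = f.
Proof.
have l := polar_coef_linear; have pl := @pol_pol_linear K g.
move: f; apply: tens_sub_ind => [v p vS _||s t IHs IHt].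
- by rewrite /polar_coef coefwise_pure // pol_pol_id.
- exact: linearP0 l.
- by rewrite (linearPD l) IHs IHt.
Qed.

Lemma tev_polar_coef c f : tev c (polar_coef f) = pol_pol (tev c f).
Proof. exact: (tev_coefwise (@pol_pol_linear K g)). Qed.

Lemma ds_polar_coef f : ds (polar_coef f) = polar_coef (ds f).
Proof. exact: (tderiv_coefwise (@pol_pol_linear K g)). Qed.

Definition polar_pair (x : form_pairs g) : form_pairs g :=
  ((polar_coef x.1.1, polar_coef x.1.2), (polar_coef x.2.1, polar_coef x.2.2)).

Lemma polar_pair_minus (x : g_Dx g) : minus_subspace g (polar_pair (cval x)).
Proof.
have [xg xw xz] := punctured_elim x.
split; rewrite /=; try exact: polar_coef_in.
- by rewrite -2![ev _ _]/(tev _ _) !tev_polar_coef xg.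
- by rewrite -[ev _ _]/(tev _ _) tev_polar_coef pol_pol_w.
- by rewrite -[ev _ _]/(tev _ _) tev_polar_coef pol_pol_z.
Qed.

(** A homotopy inverse of (i_+, i_-).  The [pol_pol] part of the functions
    vanishes at s = 0 since there they are regular in w or in z, so
    [polar_pair] lands in g_-. *)
Definition retract (x : g_Dx g) : dg_sum (g_plus g) (g_minus g) :=
  (in_carrier (pow_pow_in (tev 1 (cval x).1.1)), in_carrier (polar_pair_minus x)).

Lemma retract_cochain_map : cochain_map retract.
Proof.
have l1 := @tev_linear K (gB g) 1; have l2 := @pow_pow_linear K g; have l3 := polar_coef_linear.
split; first split.
- move=> a x y; congr pair; apply: val_inj; first by rewrite /= l1 l2.
  by apply: form_pairs_eq; rewrite /= l3.
- move=> n x; rewrite addr0; congr pair; apply: val_inj; rewrite /=.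
    by case: eqP => // _; rewrite (linearP0 l1) (linearP0 l2).
  by apply: form_pairs_eq; rewrite /=; case: eqP => // _; rewrite (linearP0 l3).
- move=> x; congr pair; apply: val_inj; rewrite /=.
    by rewrite (linearP0 l1) (linearP0 l2).
  by apply: form_pairs_eq; rewrite /= ?(linearP0 l3) ?ds_polar_coef.
Qed.

Definition i_sum (x : dg_sum (g_plus g) (g_minus g)) : g_Dx g := i_plus x.1 + i_minus x.2.

Lemma i_sum_cochain_map : cochain_map i_sum.
Proof.
have [[[pl pp] pd] _] := i_plus_dg_lie_map; have [[[ml mp] md] _] := i_minus_dg_lie_map.
have [[gpl _ _ [gdl _] _] _ _ _ _ _] := g_Dx_dg_lie.
split; first split.
- by move=> a x y; rewrite /i_sum /= pl ml scalerDr addrACA.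
- by move=> n x; rewrite /i_sum /= pp mp -(linearPD (gpl _)).
- by move=> x; rewrite /i_sum /= pd md -(linearPD gdl).
Qed.

Lemma retract_i_sum x : retract (i_sum x) = x.
Proof.
case: x => x y; have xS : gB_wz g (cval x) := cvalP x.
have [y1 y2 y3 y4 yg y5 y6] : minus_cond (cval y) := cvalP y.
have cl := @tev_linear K (gB g) 1; have pl := @pow_pow_linear K g.
have l := polar_coef_linear.
have polc : polar_coef (const_s (cval x)) = 0.
  rewrite /polar_coef coefwise_pure; last exact: pol_pol_linear.
  by rewrite (pol_pol_w (gB_wz_w xS)) (bil0l (tpure_bilinear _ _)).
have evp (z : gBs g) : gBs_polar g z -> gB_polar g (tev 1 z).
  by move=> zS; rewrite -(polar_coef_id zS) tev_polar_coef; exact: pol_pol_in.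
congr pair; apply: val_inj.
  rewrite /= (linearPD cl) (linearPD pl) [tev 1 (const_s _)]tev_const.
  by rewrite pow_pow_id // pow_pow_polar ?addr0 //; exact: evp.
apply: form_pairs_eq; rewrite /= (linearPD l) ?polc ?(linearP0 l) add0r; exact: polar_coef_id.
Qed.

(** The integral of F from s = 1, without its polar part, normalised to take the
    value c at s = 1. *)
Definition contract_form (c : gB g) (F : gBs g) : gBs g :=
  tprim_from1 F - polar_coef (tprim_from1 F) + tconst c.

Lemma tev1_contract_form c F : tev 1 (contract_form c F) = c.
Proof.
have l := @tev_linear K (gB g) 1.
rewrite (linearPD l) (linearPB _ _ l) tev_const tev_polar_coef tev1_prim_from1.
by rewrite (linearP0 (@pol_pol_linear K g)) subrr add0r.
Qed.
Lemma tev0_contract_form c F : tev 0 (contract_form c F) = c - (tint F - pol_pol (tint F)).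
Proof.
have l := @tev_linear K (gB g) 0.
rewrite (linearPD l) (linearPB _ _ l) tev_const tev_polar_coef tev0_prim_from1.
by rewrite (linearPN _ (@pol_pol_linear K g)) -opprD addrC.
Qed.
Lemma ds_contract_form c F : ds (contract_form c F) = F - polar_coef F.
Proof.
have l := @ds_linear K g.
rewrite (linearPD l) (linearPB _ _ l) [ds (tconst c)]tderiv_const ds_polar_coef.
by rewrite [ds _]tderiv_prim_from1 // addr0.
Qed.

(** The only choice with no [pow_pow] component for which both forms integrate to
    functions regular at s = 0, in w and in z respectively: the [pol_pow] part is
    dictated by F and the [pow_pol] part by H. *)
Definition glue_value (F H : gBs g) : gB g := pol_pow (tint F) + pow_pol (tint H).

Definition contract_pair (x : form_pairs g) : form_pairs g :=
  ((contract_form (glue_value x.1.2 x.2.2) x.1.2, 0),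
   (contract_form (glue_value x.1.2 x.2.2) x.2.2, 0)).

Lemma contract_punctured x : punctured_subspace g (contract_pair x).
Proof.
have E a : a - pol_pol a = pow_pow a + pow_pol a + pol_pow (a : gB g).
  by rewrite {1}[a]component_sum addrA addrK.
apply: punctured_intro; rewrite ?tev1_contract_form // tev0_contract_form /glue_value E.
  rewrite [pol_pow _ + _]addrC opprD addrACA subrr addr0 -scaleN1r addrC.
  apply: subspaceL; last exact: pow_pol_in.
  by apply: subspaceD; [exact/gB_wz_w/pow_pow_in|exact: pow_pol_in].
rewrite [X in _ - X]addrAC opprD addrACA subrr addr0 -scaleN1r addrC.
apply: subspaceL; last exact: pol_pow_in.
by apply: subspaceD; [exact/gB_wz_z/pow_pow_in|exact: pol_pow_in].
Qed.

Definition contract (x : g_Dx g) : g_Dx g := in_carrier (contract_punctured (cval x)).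

Lemma contract_form_linear (u : form_pairs g -> gB g) (v : form_pairs g -> gBs g) :
  linear u -> linear v -> linear (fun x => contract_form (u x) (v x)).
Proof.
move=> ul vl; have l1 := @tprim_from1_linear K (gB g); have l2 := polar_coef_linear.
have l3 := @tconst_linear K (gB g); have pl := lin_comp l1 vl.
exact: lin_add (lin_add pl (lin_opp (lin_comp l2 pl))) (lin_comp l3 ul).
Qed.

Lemma contract_linear : linear contract.
Proof.
have l1 : linear (fun x : form_pairs g => x.1.2) by [].
have l2 : linear (fun x : form_pairs g => x.2.2) by [].
have cl := @tint_linear K (gB g); have m1 := @pol_pow_linear K g; have m2 := @pow_pol_linear K g.
have gl : linear (fun x : form_pairs g => glue_value x.1.2 x.2.2) by rewrite /glue_value; lin.
move=> a x y; apply: val_inj; apply: form_pairs_eq; rewrite /= ?scaler0 ?addr0 //.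
- exact: (contract_form_linear gl l1 a (cval x) (cval y)).
- exact: (contract_form_linear gl l2 a (cval x) (cval y)).
Qed.

Lemma contract_degree : degree_map (0 - 1) contract.
Proof.
have l0 : contract 0 = 0 := linearP0 contract_linear.
split; first exact: contract_linear.
move=> n x; apply: val_inj; apply: form_pairs_eq; rewrite /= ?if_same //.
all: have -> : (n + (0 - 1) == 0) = (n == 1) by rewrite add0r subr_eq0.
all: case: (n == 1) => //.
- exact: (congr1 (fun z : g_Dx g => (cval z).1.1) l0).
- exact: (congr1 (fun z : g_Dx g => (cval z).2.1) l0).
Qed.

Lemma polar_coef_const v : polar_coef (tconst v) = tconst (pol_pol v).
Proof. exact: (coefwise_pure (@pol_pol_linear K g)). Qed.

Lemma contract_form_ds c f :
  contract_form c (ds f) = f - polar_coef f - tconst (tev 1 f - pol_pol (tev 1 f) - c).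
Proof.
have l := polar_coef_linear; have cl := @tconst_linear K (gB g).
rewrite /contract_form [tprim_from1 _]tprim_from1_deriv // (linearPB _ _ l) polar_coef_const.
rewrite !(linearPB _ _ cl) !opprB [tconst c + _]addrC [in RHS]addrA; congr (_ + _).
by rewrite [tconst (pol_pol _) - _]addrC addrACA [- _ + tconst _]addrC.
Qed.

(** In degree 1, differentiating the primitive returns the form up to its polar
    part.  In degree 0 the contraction of (df, dh) is (f, h) without polar part,
    up to a constant; regularity at s = 0 makes that constant the [pow_pow]
    part of the value at s = 1. *)
Lemma contract_homotopy x :
  x - i_sum (retract x) = dg_d (contract x) + contract (dg_d x).
Proof.
have [xg xw xz] := punctured_elim x.
have G : glue_value (ds (cval x).1.1) (ds (cval x).2.1) =
    pol_pow (tev 1 (cval x).1.1) + pow_pol (tev 1 (cval x).1.1).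
  rewrite /glue_value ![tint _]tint_deriv // (linearPB _ _ (@pol_pow_linear K g)).
  by rewrite (linearPB _ _ (@pow_pol_linear K g)) (pol_pow_w xw) (pow_pol_z xz) !subr0 -xg.
have P (v : gB g) : v - pol_pol v - (pol_pow v + pow_pol v) = pow_pow v.
  rewrite {1}[v]component_sum addrA addrK [pol_pow v + _]addrC opprD addrACA.
  by rewrite subrr addr0 addrK.
apply: val_inj; apply: form_pairs_eq; rewrite /= ?add0r ?addr0 ?G;
  rewrite ?contract_form_ds -?xg ?P ?ds_contract_form //.
- by rewrite opprD addrA addrAC.
- by rewrite opprD addrA addrAC.
Qed.

Lemma i_sum_equivalence : homotopy_equivalence i_sum.
Proof.
have cl := contract_linear; have [_ cd] := contract_degree.
have [[gpl _ _ [gdl _] _] _ _ _ _ _] := g_Dx_dg_lie.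
split; first exact: i_sum_cochain_map.
exists retract; split; first exact: retract_cochain_map.
- exists (fun=> 0); split; first split=> [a x y|n x].
  + by rewrite scaler0 addr0.
  + by congr pair; apply: val_inj; [rewrite /= if_same|apply: form_pairs_eq; rewrite /= if_same].
  + move=> x; rewrite -[(retract \o i_sum) x]/(retract (i_sum x)) retract_i_sum.
    have d0 := linearP0 (@ds_linear K g).
    rewrite subrr scaler0 addr0; congr pair; apply: val_inj => //.
    by apply: form_pairs_eq; rewrite /= ?d0.
- exists (fun x => - contract x); split; first split=> [a x y|n x].
  + by rewrite cl opprD scalerN.
  + by rewrite cd (linearPN _ (gpl _)).
  + move=> x; rewrite (linearPN _ gdl) scalerN /ksign expr0 scale1r -opprD.
    by rewrite -contract_homotopy opprB.
Qed.

Lemma pairing_bil :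
  bil (fun x y : g_Dx g => (pairing_form kappa (cval x) (cval y) : K^o)).
Proof.
have [pl pr] := pairing_form_bil kP.
by split=> [y|x] a x1 x2; [exact: (pl (cval y) a)|exact: (pr (cval x) a)].
Qed.

Lemma pairing_pure (x y : g_Dx g) : pairing kappa (x \ox y) = pairing_form kappa (cval x) (cval y).
Proof. exact: (tlift_pure pairing_bil). Qed.

Lemma pairing_linear : linear (pairing kappa : tens (g_Dx g) (g_Dx g) -> K^o).
Proof. exact: (tlift_linear pairing_bil). Qed.

(** Turns the sums over all degrees in the definition of the tensor product of dg
    spaces into two-term sums. *)
Lemma fsum_01 (V : lmodType K) (F : int -> V) :
  (forall i, i != 0 -> i != 1 -> F i = 0) ->
  \sum_(i \in [set: int]) F i = F 0 + F 1.
Proof.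
move=> F0; rewrite (fsbigTE [fset (0 : int); 1]%fset); last first.
  by move=> i; rewrite !inE negb_or => /andP[]; exact: F0.
by rewrite big_fsetU1 ?inE //= big_seq_fset1.
Qed.

Lemma g_Dx_part (x : g_Dx g) i : i != 0 -> i != 1 -> dg_part i x = 0.
Proof.
move=> /negbTE i0 /negbTE i1; apply: val_inj; apply: form_pairs_eq;
by rewrite /= ?i0 ?i1.
Qed.

Definition part_tens n (x y : g_Dx g) : tens (g_Dx g) (g_Dx g) :=
  dg_part 0 x \ox dg_part n y + dg_part 1 x \ox dg_part (n - 1) y.

Lemma part_tens_bil n : bil (part_tens n).
Proof.
have pP := tpure_bilinear (g_Dx g) (g_Dx g).
have [[gpl _ _ [gdl _] _] _ _ _ _ _] := g_Dx_dg_lie.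
by split=> z; apply: lin_add;
  [apply: (lin_l _ pP)|apply: (lin_l _ pP)|apply: (lin_r _ pP)|apply: (lin_r _ pP)].
Qed.

Lemma dg_part_tensE n (t : dg_tens (g_Dx g) (g_Dx g)) : dg_part n t = tlift (part_tens n) t.
Proof.
rewrite -[LHS]/(tlift (fun x y : g_Dx g =>
  \sum_(i \in [set: int]) dg_part i x \ox dg_part (n - i) y) t).
congr (tlift _ t); apply/funext => u; apply/funext => v.
rewrite fsum_01 ?subr0 // => i i0 i1.
by rewrite (g_Dx_part u i0 i1) (bil0l (tpure_bilinear _ _)).
Qed.

Lemma dg_sign_g_Dx (x : g_Dx g) : dg_sign x = dg_part 0 x - dg_part 1 x.
Proof.
rewrite /dg_sign fsum_01 /ksign ?expr0 ?expr1 ?scale1r ?scaleN1r // => i i0 i1.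
by rewrite g_Dx_part // scaler0.
Qed.

Lemma dg_d_tens_bil : bil (fun x y : g_Dx g => dg_d x \ox y + dg_sign x \ox dg_d y).
Proof.
have pP := tpure_bilinear (g_Dx g) (g_Dx g).
have [[gpl _ _ [gdl _] _] _ _ _ _ _] := g_Dx_dg_lie.
have p0 := gpl 0; have p1 := gpl 1.
have sl : linear (@dg_sign K (g_Dx g)).
  move=> a u v; rewrite !dg_sign_g_Dx p0 p1 opprD addrACA; congr (_ + _).
  by rewrite scalerBr.
by split=> z; apply: lin_add;
  [apply: (lin_l _ pP)|apply: (lin_l _ pP)|apply: (lin_r _ pP)|apply: (lin_r _ pP)].
Qed.

Lemma pairing_cochain_map : cochain_map (pairing kappa).
Proof.
have l := pairing_linear; have qP := int_form_bil kP.
have pfE := pairing_formE kappa.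
split; first split; first exact: l.
- move=> n t; rewrite addr0 dg_part_tensE /=.
  have tl := tlift_linear (part_tens_bil n).
  move: t; apply: (@tens_ext K _ _ K^o
    (fun t => pairing kappa (tlift (part_tens n) t))
    (fun t => if n == 1 then pairing kappa t else 0)) => [||x y].
  + exact: lin_comp l tl.
  + by case: eqP => _; [exact: l|exact: lin_0].
  + rewrite (tlift_pure (part_tens_bil n)) (linearPD l) !pairing_pure !pfE /=.
    rewrite !(bil0l qP) !add0r !addr0 subr_eq0.
    case: (n == 1); rewrite ?(bil0r qP) ?subrr ?mulr0 ?addr0 //.
    rewrite -mulrDr; congr (_ * _); ring.
- move=> t; rewrite /=.
  have tl := tlift_linear dg_d_tens_bil.
  move: t; apply: (@tens_ext K _ _ K^o
  (fun t => pairing kappa (tlift _ t)) (fun t => 0)) => [||x y].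
  + exact: lin_comp l tl.
  + exact: lin_0.
  + rewrite (tlift_pure dg_d_tens_bil) (linearPD l) !pairing_pure dg_sign_g_Dx.
    have hx : homog 0 (cval (dg_part 0 x) : form_pairs g).
      by apply: form_pairs_eq.
    have := pairing_form_inv_d kP char0 (cvalP (dg_part 0 x)) (cvalP y) hx.
    rewrite /ksign expr0 mul1r !pfE /= ?(bil0l qP, bil0r qP) !subr0.
    exact.
Qed.

Lemma pairing_i_plus (t : tens (g_plus g) (g_plus g)) :
  pairing kappa (tmap (@i_plus K g) (@i_plus K g) t) = 0.
Proof.
have il := i_plus_linear; have l := lin_comp pairing_linear (tmap_linear il il).
have qP := int_form_bil kP.
move: t; apply: (@tens_ext K _ _ K^o
  (fun t => pairing kappa (tmap _ _ t)) (fun t => 0)) => [//||x y].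
  exact: lin_0.
rewrite (tmap_pure il il) pairing_pure pairing_formE //=.
by rewrite !(bil0l qP, bil0r qP) !addr0 subrr mulr0.
Qed.

Lemma pairing_i_minus (t : tens (g_minus g) (g_minus g)) :
  pairing kappa (tmap (@i_minus K g) (@i_minus K g) t) = 0.
Proof.
have il := i_minus_linear; have l := lin_comp pairing_linear (tmap_linear il il).
move: t; apply: (@tens_ext K _ _ K^o
  (fun t => pairing kappa (tmap _ _ t)) (fun t => 0)) => [//||x y].
  exact: lin_0.
rewrite (tmap_pure il il) pairing_pure pairing_formE //=.
have [x1 x2 x3 x4 _ _ _] : minus_cond (cval x) := cvalP x.
have [y1 y2 y3 y4 _ _ _] : minus_cond (cval y) := cvalP y.
by rewrite !int_form_polar // !addr0 subrr mulr0.
Qed.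

Lemma homotopic_zero (V W : dg_data K) k (f : V -> W) : dg_d (0 : W) = 0 ->
  (forall n, dg_part n (0 : W) = 0) -> (forall x, f x = 0) -> homotopic k f (fun=> 0).
Proof.
move=> d0 p0 f0; exists (fun=> 0); split; first split=> [|n x].
- exact: lin_0.
- by rewrite p0.
- by move=> x; rewrite f0 subrr d0 scaler0 addr0.
Qed.

(** Against a cocycle y the homotopy contributes eta(dy) = 0, so x pairs to zero
    with all cocycles; it suffices to test one-forms supported on the first
    component and the constants coming from g_+. *)
Lemma pairing_nondeg i (x : g_Dx g) : homog i x -> dg_d x = 0 ->
  homotopic i ((fun y => pairing kappa (x \ox y)) : g_Dx g -> dg_line K 1) (fun=> 0) ->
  exists y : g_Dx g, x = dg_d y.
Proof.
move=> /homog_cval/homog_pairsP xi dx [eta [[etal _] etaE]].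
have qP := int_form_bil kP; have rP := res_form_bil kP.
have dl := @ds_linear K g; have d0 := linearP0 dl; have tcl := @tconst_linear K (gB g).
have half0 (a : K) : 2^-1 * a = 0 -> a = 0.
  by move/eqP; rewrite mulf_eq0 invr_eq0 (negbTE (char0 1)) => /eqP.
have pair0 (y : g_Dx g) : dg_d y = 0 -> pairing_form kappa (cval x) (cval y) = 0.
  move=> dy; have := etaE y; rewrite dy (linearP0 etal) scaler0 /= addr0 subr0.
  by rewrite pairing_pure.
have [xg xw xz] := punctured_elim x.
have xd1 : ds (cval x).1.1 = 0 := congr1 (fun z : g_Dx g => (cval z).1.2) dx.
have xd2 : ds (cval x).2.1 = 0 := congr1 (fun z : g_Dx g => (cval z).2.2) dx.
have tc0 := linearP0 (@tev_linear K (gB g) 0); have tc1 := linearP0 (@tev_linear K (gB g) 1).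
case: x xi pair0 xg xw xz xd1 xd2 {dx etaE} => v vP /= xi.
case: xi vP => [f h|F H|n] vP pair0 xg xw xz xd1 xd2 /=.
- have const_of (k : gBs g) : ds k = 0 -> k = tconst (tev 1 k).
    move=> dk; have := tprim_from1_deriv char0 k; rewrite -[tderiv _]/(ds _) dk.
    by rewrite (linearP0 (@tprim_from1_linear K (gB g))) => /esym/subr0_eq.
  have f0 : tev 1 f = 0.
    apply: (res_form_nondeg kP) => b.
    have bS : punctured_subspace g ((0, tconst b), (0, 0)).
      by apply: punctured_intro; rewrite ?tc0 ?tc1 //; exact: subspace0.
    have dbS : dg_d (in_carrier bS : g_Dx g) = 0.
      by apply: val_inj; apply: form_pairs_eq; rewrite /= ?d0.
    have := pair0 _ dbS; rewrite pairing_formE /= !(bil0l qP, bil0r qP) !addr0 subr0.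
    by move/half0; rewrite (const_of f xd1) (int_form_constr kP) tint_const // tev_const.
  exists 0; apply: val_inj; apply: form_pairs_eq; rewrite /= ?d0 //.
    by rewrite (const_of f xd1) f0 (linearP0 tcl).
  by rewrite (const_of h xd2) -xg f0 (linearP0 tcl).
- set D := tint F - tint H.
  have D0 : pol_pol D = 0.
    apply: (res_form_nondeg_pol_pol kP) => b bS.
    have dbS : dg_d (i_plus (in_carrier bS : g_plus g)) = 0.
      by apply: val_inj; apply: form_pairs_eq; rewrite /= ?[ds (const_s _)]tderiv_const.
    have := pair0 _ dbS; rewrite pairing_formE /= !(bil0l qP, bil0r qP) !add0r.
    by move/half0; rewrite !(int_form_constr kP) -(linearPB _ _ (rP.1 b)).
  have tl0 := @tev_linear K (gB g) 0; have tl1 := @tev_linear K (gB g) 1.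
  have yS : punctured_subspace g ((tprim F - tconst (pow_pow D + pow_pol D), 0),
                                  (tprim H + tconst (pol_pow D), 0)).
    (* The constants differ by D, as pol_pol D = 0. *)
    apply: punctured_intro.
    + rewrite (linearPB _ _ tl1) (linearPD tl1) !tev_const.
      apply/eqP; rewrite subr_eq -addrA [pol_pow D + _]addrC.
      by rewrite -[pol_pow D]addr0 -D0 -component_sum /D subrKC.
    + rewrite (linearPB _ _ tl0) tev0_prim tev_const -scaleN1r addrC.
      apply: subspaceL; last exact: subspace0.
      by apply: subspaceD; [exact/gB_wz_w/pow_pow_in|exact: pow_pol_in].
    + rewrite (linearPD tl0) tev0_prim tev_const add0r; exact: pol_pow_in.
  exists (in_carrier yS); apply: val_inj; apply: form_pairs_eq => //=.
    by rewrite (linearPB _ _ dl) [ds (tprim _)]tderiv_prim // [ds (tconst _)]tderiv_const subr0.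
  by rewrite (linearPD dl) [ds (tprim _)]tderiv_prim // [ds (tconst _)]tderiv_const addr0.
- by exists 0; apply: val_inj; apply: form_pairs_eq; rewrite /= ?d0.
Qed.

(** Characteristic 0 makes polynomials in s integrable and 2 invertible. *)
Theorem homotopy_manin_triple_g_Dx : homotopy_manin_triple (g_Dx g) (g_plus g) (g_minus g)
    (@i_plus _ g) (@i_minus _ g) 1 (pairing kappa).
Proof.
split.
- exact: g_Dx_dg_lie.
- exact: g_plus_dg_lie.
- exact: g_minus_dg_lie.
- exact: i_plus_dg_lie_map.
- exact: i_minus_dg_lie_map.
- exact: pairing_cochain_map.
- exact: i_sum_equivalence.
- move=> i j x y /homog_cval/homog_pairsP xi /homog_cval/homog_pairsP yj.
  have qP := int_form_bil kP.
  rewrite !pairing_pure (pairing_form_sym kP) !pairing_formE.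
  case: xi => [f h|F H|n]; case: yj => [f' h'|F' H'|n'] /=;
  rewrite /ksign ?expr0 ?scale1r ?(bil0l qP, bil0r qP) ?addr0 ?subrr ?mulr0 ?scaler0 //.
- move=> i j k x y z /homog_cval hx /homog_cval hy _.
  by rewrite !pairing_pure; exact: (pairing_form_inv kP _ hx hy).
- move=> i j x y /homog_cval hx _; rewrite !pairing_pure.
  exact: (pairing_form_inv_d kP char0 (cvalP x) (cvalP y) hx).
- exact: pairing_nondeg.
- by apply: homotopic_zero => [//|n|t]; [rewrite /= if_same|exact: pairing_i_plus].
- by apply: homotopic_zero => [//|n|t]; [rewrite /= if_same|exact: pairing_i_minus].
Qed.

End ManinTriple.

Theorem theorem14 (R : realType) (g : lie_algebra R[i]) (kappa : g -> g -> R[i])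
  (g_simple : simple_lie g) (kappa_form : invariant_form kappa) :
  homotopy_manin_triple (g_Dx g) (g_plus g) (g_minus g)
    (@i_plus _ g) (@i_minus _ g) 1 (pairing kappa).
Proof.
by apply: homotopy_manin_triple_g_Dx => // n; rewrite pnatr_eq0.
Qed.
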